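(* For every prime power $q$, the formal power series $\mathsf{T}(z)=\sum_{\Xi}\tfrac12\,\delta(\Xi)\,z^{|\Xi|}$ (sum over all orthogonal symbols $\Xi$ of even defect and non-negative rank) satisfies $$\mathsf{T}(z)=\prod_{i\ge1}\frac{1+z/q^{2i-1}}{1-z/q^{2i-1}}\ \prod_{\substack{1\le i<j\\ i+j\text{ odd}}}\frac{1}{1-z^2/q^{i+j}}.$$
   Context: An orthogonal symbol is an ordered pair $\Xi=(\mu,\nu)$ of finite sets of non-negative integers $\mu=\{\mu_1<\cdots<\mu_r\}$, $\nu=\{\nu_1<\cdots<\nu_k\}$ such that $0$ does not lie in both $\mu$ and $\nu$. Its defect is $|r-k|$ and its rank is $|\Xi|=\sum_i\mu_i+\sum_j\nu_j-\lfloor((r+k-1)/2)^2\rfloor$. The only one of rank $0$ with even defect is $(\varnothing,\varnothing)$, and $\delta((\varnothing,\varnothing))=2$. For any other $\Xi$ of even defect (so $N=r+k$ is even), set $c_N=\sum_{i=1}^{(N-2)/2}\binom{N-2i}{2}$ and $$\delta(\Xi)=\frac{\prod_{1\le i<j\le r}(q^{\mu_j}-q^{\mu_i})\prod_{1\le i<j\le k}(q^{\nu_j}-q^{\nu_i})\prod_{i=1}^r\prod_{j=1}^k(q^{\mu_i}+q^{\nu_j})}{2^{(N-2)/2}\,q^{c_N}\prod_{i=1}^r\prod_{j=1}^{\mu_i}(q^{2j}-1)\prod_{i=1}^k\prod_{j=1}^{\nu_i}(q^{2j}-1)}.$$ (Equivalently, for $n>0$ the coefficient of $z^n$ in $\mathsf{T}(z)$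 is $\frac12\big(\frac{U^+_n}{(q^n-1)\prod_{i=1}^{n-1}(q^{2i}-1)}+\frac{U^-_n}{(q^n+1)\prod_{i=1}^{n-1}(q^{2i}-1)}\big)$, where $U^\pm_n$ is the sum of the degrees of the unipotent characters of $\mathrm{O}^\pm(2n,\mathbb{F}_q)$.) *)

(* Defs.v *)
From HB Require Import structures.
From mathcomp Require Import all_boot all_order all_algebra finmap.
From mathcomp Require Import all_classical all_reals all_analysis.

Set Implicit Arguments.
Unset Strict Implicit.
Unset Printing Implicit Defensive.
Import Order.TTheory GRing.Theory Num.Theory.
Local Open Scope classical_set_scope.
Local Open Scope ring_scope.
Local Open Scope fset_scope.

Definition symbol := ({fset nat} * {fset nat})%type.

Definition is_ortho_symbol (X : symbol) : Prop :=
  ~ ((0%N \in X.1) && (0%N \in X.2)).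

Definition symN (X : symbol) : nat := (#|` X.1| + #|` X.2|)%N.

(* even defect: |r - k| even, i.e. r + k even *)
Definition even_defect (X : symbol) : bool := ~~ odd (symN X).

(* rank |Xi| = sum mu_i + sum nu_j - floor(((r+k-1)/2)^2);
   for the integer m = r+k-1 we have floor((m/2)^2) = floor(m^2/4). *)
Definition sym_rank (X : symbol) : int :=
  ((\sum_(a <- X.1) a + \sum_(b <- X.2) b)%N)%:Z
  - (((symN X)%:Z - 1) ^+ 2 %/ 4)%Z.

Definition cN (N : nat) : nat :=
  (\sum_(1 <= i < (N - 2)./2.+1) 'C(N - 2 * i, 2))%N.

Definition delta (R : realType) (q : R) (X : symbol) : R :=
  if (X.1 == fset0) && (X.2 == fset0) then 2 else
  let N := symN X in
  (\prod_(a <- X.1) \prod_(b <- X.1 | (a < b)%N) (q ^+ b - q ^+ a))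
  * (\prod_(a <- X.2) \prod_(b <- X.2 | (a < b)%N) (q ^+ b - q ^+ a))
  * (\prod_(a <- X.1) \prod_(b <- X.2) (q ^+ a + q ^+ b))
  / (2 ^+ ((N - 2)./2) * q ^+ (cN N)
     * (\prod_(a <- X.1) \prod_(1 <= j < a.+1) (q ^+ (2 * j) - 1))
     * (\prod_(a <- X.2) \prod_(1 <= j < a.+1) (q ^+ (2 * j) - 1))).

(* coefficient of z^n in T(z) = sum_Xi (1/2) delta(Xi) z^|Xi|, the sum
   ranging over orthogonal symbols of even defect and non-negative rank
   (the set of such symbols of rank n is finite). *)
Definition T_coef (R : realType) (q : R) (n : nat) : R :=
  \sum_(X \in [set X : symbol | is_ortho_symbol X /\ even_defect X
                                /\ sym_rank X = n%:Z]) (2^-1 * delta q X).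

Definition pser (R : realType) := nat -> R.

Definition ps_one (R : realType) : pser R := fun n => (n == 0%N)%:R.

Definition ps_mul (R : realType) (f g : pser R) : pser R :=
  fun n => \sum_(k < n.+1) f k * g (n - k)%N.

Definition ps_lin (R : realType) (a : R) : pser R :=
  fun n => if n == 0%N then 1 else if n == 1%N then a else 0.

(* 1/(1 - a z) = sum_m a^m z^m *)
Definition ps_geom (R : realType) (a : R) : pser R := fun n => a ^+ n.

(* 1/(1 - b z^2) = sum_m b^m z^(2m) *)
Definition ps_geom2 (R : realType) (b : R) : pser R :=
  fun n => if odd n then 0 else b ^+ n./2.

Definition partial_prod (R : realType) (q : R) (M : nat) : pser R :=
  ps_mul
    (\big[@ps_mul R/@ps_one R]_(1 <= i < M.+1)
        ps_mul (ps_lin (q ^- (2 * i - 1))) (ps_geom (q ^- (2 * i - 1))))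
    (\big[@ps_mul R/@ps_one R]_(1 <= i < M.+1)
        \big[@ps_mul R/@ps_one R]_(i.+1 <= j < M.+1 | odd (i + j))
          ps_geom2 (q ^- (i + j))).

(* Main.v *)
Require Import Defs.
From HB Require Import structures.
From mathcomp Require Import all_boot all_order all_algebra.
From mathcomp Require Import all_classical all_reals all_analysis.
From mathcomp Require Import all_fingroup ring zify finmap.
Set Implicit Arguments.
Unset Strict Implicit.
Unset Printing Implicit Defensive.
Import Order.TTheory GRing.Theory Num.Theory numFieldNormedType.Exports.
Local Open Scope classical_set_scope.
Local Open Scope ring_scope.

(* Give the points of the symbol [(A, B)] the values [q^a] for [a] in [A] and
   [- q^b] for [b] in [B], so that the numerator of [delta] is the absolute value of
   a Vandermonde determinant; listing the points by increasing absolute value, it is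
   the determinant times the product of the signs raised to the positions.  Adding a
   point [0] on both sides after shifting all entries by one changes neither rank nor
   [delta], so for [M >= n] the coefficient [T_n] is the sum over all pairs [(A, B)]
   with [#A + #B = 2 M] and rank [n], without the orthogonality condition.

   Summing over the signs of the points keeps only the even columns in rows of even
   position and the odd columns in rows of odd position.  The remaining sum over
   interlacing sequences is, by an alternating-form argument, a single [M x M]
   determinant.  In a Newton basis adapted to the points it is a Toeplitz
   determinant, with symbol
     (1 + t) / (1 - t) * prod_i (1 + z t q^(-2i)) * prod_i (1 + z t^(-1) q^(1-2i)).
   When both products are cut at [i <= m], that determinant is computed modulo
   [z^(M+1)] by evaluating at the zeros of the polynomial in [1/t] (a formal version of
   Szego's limit theorem), which gives the finite products of the statement.  The
   coefficients of the cut products converge to [1 / prod_j (q^(2j) - 1)] as [m] grows,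
   and [partial_prod] is squeezed between two such cut products. *)

(** * Alternating forms on lists and the summation over signs *)

Section AlternatingLists.
Variables (A : comNzRingType) (V : lmodType A).

(** Lists of arbitrary length let the recursions below insert vectors by consing. Vanishing on
    adjacent repeats suffices: the swap lemmas give the repeats at distance two. *)
Definition alternating (f : seq V -> A) : Prop :=
  (forall s c a b t, f (s ++ (c *: a + b) :: t)
     = c * f (s ++ a :: t) + f (s ++ b :: t)) /\
  (forall s a t, f (s ++ [:: a, a & t]) = 0).

Section Theory.
Variables (f : seq V -> A) (f_alt : alternating f).

Lemma altD s a b t : f (s ++ (a + b) :: t) = f (s ++ a :: t) + f (s ++ b :: t).
Proof. by rewrite -[a]scale1r f_alt.1 mul1r scale1r. Qed.

Lemma alt0 s t : f (s ++ 0 :: t) = 0.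
Proof. by have := altD s 0 0 t; rewrite addr0 => /eqP; rewrite -subr_eq subrr => /eqP. Qed.

Lemma altZ s c a t : f (s ++ (c *: a) :: t) = c * f (s ++ a :: t).
Proof. by rewrite -[c *: a]addr0 f_alt.1 alt0 addr0. Qed.

Lemma altN s a t : f (s ++ (- a) :: t) = - f (s ++ a :: t).
Proof. by rewrite -scaleN1r altZ mulN1r. Qed.

Lemma alt_swap s a b t : f (s ++ [:: b, a & t]) = - f (s ++ [:: a, b & t]).
Proof.
have := f_alt.2 s (a + b) t.
have D2 x : f (s ++ [:: x, a + b & t]) = f (s ++ [:: x, a & t]) + f (s ++ [:: x, b & t]).
  by have := altD (rcons s x) a b t; rewrite !cat_rcons.
by rewrite altD !D2 !f_alt.2 add0r addr0 addrC => /eqP; rewrite addr_eq0 => /eqP.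
Qed.

Lemma alt_swapr s x a b t : f (s ++ [:: x, b, a & t]) = - f (s ++ [:: x, a, b & t]).
Proof. by have := alt_swap (rcons s x) a b t; rewrite !cat_rcons. Qed.

Lemma alt_swap2 s a b c t : f (s ++ [:: c, b, a & t]) = - f (s ++ [:: a, b, c & t]).
Proof. by rewrite (alt_swap s b) alt_swapr opprK alt_swap. Qed.

Lemma alt_dup2 s a b t : f (s ++ [:: a, b, a & t]) = 0.
Proof.
by rewrite alt_swap; have := f_alt.2 (rcons s b) a t; rewrite cat_rcons => ->; rewrite oppr0.
Qed.

End Theory.

Section PairSums.
Variables (f : seq V -> A) (f_alt : alternating f).
Variables (e o : nat -> V) (N : nat).
Hypotheses (evenN : ~~ odd N) (f_size : forall t, size t != N -> f t = 0).

Definition psum L : V := \sum_(a < L) e a.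
(** Even-position partners [a] of an odd-position index [b]: weight 2 if [a < b], weight 1 if
    [a = b]. Partners should also lie above the previous odd-position index [c], but that restricted
    sum is [pmid b - pmid c], and [pmid c] already stands in the list, so alternation removes the
    restriction. *)
Definition pmid L : V := 2 *: psum L + e L.

(** Unfolds to the sum over [b_1 < ... < b_p < L] of [2^p] times [f] at
    [pmid b_1, o b_1, ..., pmid b_p, o b_p] followed by [t]. *)
Fixpoint pair_sum L t : A :=
  if L is L'.+1 then pair_sum L' t + 2 * pair_sum L' [:: pmid L', o L' & t]
  else f t.

Lemma alternating_pair_sum L : alternating (pair_sum L).
Proof.
elim: L => [|L [IH1 IH2]] //=; split=> [s c a b t|s a t] /=.
  rewrite IH1 -[[:: _, _ & s ++ (_ + _) :: t]]/([:: pmid L, o L & s] ++ _) IH1 /=.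
  by ring.
by rewrite IH2 -[[:: _, _ & s ++ _]]/([:: pmid L, o L & s] ++ _) IH2 mulr0 addr0.
Qed.

Lemma pair_sum_size L t : (N < size t)%N -> pair_sum L t = 0.
Proof.
elim: L t => [|L IH] t lt_Nt /=; first by rewrite f_size // gtn_eqF.
by rewrite !IH ?mulr0 ?addr0 //= ltnW // ltnW.
Qed.

(* A pair [(b, a)] stands for the point [(-1)^b q^a]. *)
Definition signed_vec (x : bool * nat) : V := e x.2 + (-1) ^+ x.1 *: o x.2.

(* In a list of even length, the element followed by [t] has 0-based position of
   parity [~~ odd (size t)]. *)
Fixpoint alt_sign (s : seq (bool * nat)) : A :=
  if s is x :: t then (if odd (size t) then 1 else (-1) ^+ x.1) * alt_sign t
  else 1.

Fixpoint word_sum (g : seq (bool * nat) -> A) L t : A :=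
  if L is L'.+1 then
    word_sum g L' t + word_sum g L' ((true, L') :: t)
    + word_sum g L' ((false, L') :: t)
    + word_sum g L' [:: (true, L'), (false, L') & t]
  else g t.

(* Summing over the sign of a point leaves twice its even or its odd part, according to
   the parity of its position; adding both signs gives twice the product of the two. *)
Lemma word_sum_pair_sum L t :
  word_sum (fun s => alt_sign s * f (map signed_vec s)) L t =
  alt_sign t * (if odd (size t) then 2 * pair_sum L (psum L :: map signed_vec t)
                else pair_sum L (map signed_vec t)).
Proof.
(* When [size t] is odd, the head of [t] has odd position and still awaits its partner; [2 * psum L]
   collects the candidates below [L]. At level 0 none is left: [psum 0 = 0], and [f] vanishes on
   lists of odd length. *)
elim: L t => [|L IH] t /=.
  case: ifP => // odd_t; rewrite /psum big_ord0 (alt0 f_alt [::]).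
  rewrite f_size ?mulr0 // size_map; apply: contra evenN => /eqP <-.
  by rewrite odd_t.
have alt_p := alternating_pair_sum L.
rewrite !IH /=; set T := map signed_vec t; set p := pair_sum L.
have D1 := altD alt_p [::]; have D2 x := altD alt_p [:: x].
have Z1 := altZ alt_p [::]; have Z2 x := altZ alt_p [:: x].
have N1 := altN alt_p [::]; have N2 x := altN alt_p [:: x].
have D3 x y := altD alt_p [:: x; y]; have N3 x y := altN alt_p [:: x; y].
rewrite /= -/p in D1 D2 D3 Z1 Z2 N1 N2 N3.
have A1 x T' : p [:: x, x & T'] = 0 by apply: (alt_p.2 [::]).
have A2 x y T' : p [:: x, y, x & T'] = 0 by apply: (alt_dup2 alt_p [::]).
have A3 x y T' : p [:: x, y, y & T'] = 0 by apply: (alt_p.2 [:: x]).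
have S12 x y T' : p [:: y, x & T'] = - p [:: x, y & T'] by apply: (alt_swap alt_p [::]).
have S23 z x y T' : p [:: z, y, x & T'] = - p [:: z, x, y & T']
  by apply: (alt_swap alt_p [:: z]).
have S13 x y z T' : p [:: z, y, x & T'] = - p [:: x, y, z & T']
  by apply: (alt_swap2 alt_p [::]).
rewrite /signed_vec /= expr0 expr1 scale1r scaleN1r.
case: ifP => odd_t /=; rewrite /psum ?big_ord_recr /= -/(psum L) /pmid.
  rewrite !(D1, D2, D3, Z1, Z2, N1, N2, N3) !(A1, A2, A3).
  (* Brings all surviving terms to the order [psum L, o L, e L], so that [ring] can compare them. *)
  rewrite (S23 (psum L) (o L) (e L)) (S13 (psum L) (o L) (e L)).
  by ring.
rewrite !(D1, D2, D3, Z1, Z2, N1, N2, N3) !(A1, A2, A3) (S12 (e L) (o L)).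
by ring.
Qed.

Definition index_pairs (s : seq nat) : seq V :=
  flatten [seq [:: pmid a; o a] | a <- s].

Fixpoint nest_sum L p s : A :=
  if p is p'.+1 then \sum_(a < L) nest_sum L p' (nat_of_ord a :: s)
  else f (index_pairs s).

Lemma size_index_pairs s : size (index_pairs s) = (size s).*2.
Proof. by elim: s => //= a s ->. Qed.

Lemma index_pairs_cat s t : index_pairs (s ++ t) = index_pairs s ++ index_pairs t.
Proof. by rewrite /index_pairs map_cat flatten_cat. Qed.

(** Exchanging two blocks of two vectors is an even permutation. Hence the sum over increasing
    indices can be replaced by a sum over all tuples. *)
Lemma nest_sum_swap L p u a b s :
  nest_sum L p (u ++ [:: b, a & s]) = nest_sum L p (u ++ [:: a, b & s]).
Proof.
elim: p u => [|p IH] u /=; last by apply: eq_bigr => c _; apply: (IH (_ :: u)).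
rewrite !index_pairs_cat /= -[_ ++ [:: pmid b, _ & _]]/(_ ++ [:: pmid b; o b; pmid a; o a] ++ _).
rewrite -[X in _ = f (_ ++ X)]/([:: pmid a; o a; pmid b; o b] ++ index_pairs s).
set I := index_pairs s; set U := index_pairs u => /=.
rewrite (alt_swap2 f_alt) -cat_rcons (alt_swap2 f_alt _ (o a)) !cat_rcons opprK.
by [].
Qed.

Lemma nest_sum_dup L p u a s : nest_sum L p (u ++ [:: a, a & s]) = 0.
Proof.
elim: p u => [|p IH] u /=; last by apply: big1 => c _; apply: (IH (_ :: u)).
by rewrite !index_pairs_cat /= alt_dup2.
Qed.

(** At most one of the [p] indices equals [L], since repeats give 0, and by symmetry each of its [p]
    places contributes the same. *)
Lemma nest_sumSl L p s :
  nest_sum L.+1 p s = nest_sum L p s + p%:R * nest_sum L p.-1 (L :: s).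
Proof.
elim: p s => [|p IH] s /=; first by rewrite mul0r addr0.
under eq_bigr do rewrite IH.
rewrite big_ord_recr /= big_split /= -!addrA; congr (_ + _).
rewrite (nest_sum_dup L p.-1 [::]) mulr0 addr0 -mulr_sumr.
case: p {IH} => [|p] /=; first by rewrite !mul0r add0r mul1r.
under eq_bigr do rewrite (nest_sum_swap L p [::]) /=.
by rewrite [in RHS]mulrSr; ring.
Qed.

(** Each set of [p] indices is met [p!] times among the tuples; the factorial stays on the left
    because [A] is only a ring. *)
Lemma pair_sum_nest_sum L p s : (p + size s).*2 = N ->
  p`!%:R * pair_sum L (index_pairs s) = 2 ^+ p * nest_sum L p s.
Proof.
elim: L p s => [|L IH] p s defN.
  case: p defN => [|p] defN /=; first by rewrite !mul1r.
  rewrite big_ord0 f_size ?mulr0 // size_index_pairs -defN addSn doubleS.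
  by rewrite neq_ltn ltnS leqW // leq_double leq_addl.
rewrite nest_sumSl /= mulrDr IH // mulrDr; congr (_ + _).
rewrite -[[:: _, _ & _]]/(index_pairs (L :: s)).
case: p defN => [|p] defN.
  rewrite pair_sum_size ?mul0r ?mulr0 // size_index_pairs -defN.
  by rewrite ltn_double.
have := IH p (L :: s); rewrite /= addnS -addSn => /(_ defN) eqp.
rewrite factS natrM exprS /=.
transitivity (2 * p.+1%:R * (p`!%:R * pair_sum L (index_pairs (L :: s)))); first by ring.
by rewrite eqp; ring.
Qed.

End PairSums.
End AlternatingLists.

(** * The determinant as an alternating form on lists *)

Section ListDeterminant.
Variables (A : comNzRingType) (n : nat).

Definition list_det (t : seq 'rV[A]_n) : A :=
  if size t == n then \det (\matrix_(i < n) t`_i) else 0.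

Lemma list_det_size t : size t != n -> list_det t = 0.
Proof. by rewrite /list_det => /negPf ->. Qed.

Lemma nth_cat_change (T : Type) (x0 : T) (s t : seq T) a b i :
  i != size s -> nth x0 (s ++ a :: t) i = nth x0 (s ++ b :: t) i.
Proof.
rewrite !nth_cat; case: ltnP => // le_si ne_si.
by rewrite -(subnSK (_ : size s < i)%N) // ltn_neqAle eq_sym ne_si.
Qed.

Lemma alternating_list_det : alternating list_det.
Proof.
split=> [s c a b t|s a t]; rewrite /list_det !size_cat /=; last first.
  case: eqP => // defn.
  have lt1 : (size s < n)%N.
    by apply: leq_trans (eq_leq defn); rewrite !addnS ltnS leqW // leq_addr.
  have lt2 : ((size s).+1 < n)%N.
    by apply: leq_trans (eq_leq defn); rewrite !addnS !ltnS leq_addr.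
  apply: (@determinant_alternate _ _ _ (Ordinal lt1) (Ordinal lt2)).
    by rewrite -val_eqE /= neq_ltn ltnSn.
  by move=> j; rewrite !mxE !nth_cat /= ltnn subnn ltnNge leqnSn subSnn.
case: eqP => [defn|_]; last by rewrite mulr0 addr0.
have lt1 : (size s < n)%N.
  by apply: leq_trans (eq_leq defn); rewrite addnS ltnS leq_addr.
rewrite -[X in _ = _ + X]mul1r.
have lift_ne (i : 'I_n.-1) : (lift (Ordinal lt1) i : nat) != size s.
  by rewrite eq_sym -[size s]/(nat_of_ord (Ordinal lt1)) val_eqE neq_lift.
apply: (@determinant_multilinear _ _ _ _ _ (Ordinal lt1)).
- by rewrite !rowK scale1r !nth_cat /= ltnn subnn.
- by apply/matrixP=> i j; rewrite !mxE (@nth_cat_change _ _ _ _ a (c *: a + b)).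
- by apply/matrixP=> i j; rewrite !mxE (@nth_cat_change _ _ _ _ b (c *: a + b)).
Qed.

End ListDeterminant.

(** * Checkerboard determinants and the Andréief identity *)

Section Checkerboard.
Variables (A : comNzRingType) (M : nat).

Lemma even_ord_proof (i : 'I_M) : (i.*2 < M + M)%N.
Proof. by rewrite addnn ltn_double. Qed.

Lemma odd_ord_proof (i : 'I_M) : (i.*2.+1 < M + M)%N.
Proof. by rewrite addnn ltn_Sdouble. Qed.

Definition even_ord i : 'I_(M + M) := Ordinal (even_ord_proof i).
Definition odd_ord i : 'I_(M + M) := Ordinal (odd_ord_proof i).

(** One permutation, even indices first, is applied to both rows and columns, so its sign cancels
    and a block diagonal matrix remains. *)
Lemma det_checkerboard (B : 'M[A]_(M + M)) :
    (forall i j : 'I_(M + M), odd i != odd j -> B i j = 0) ->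
  \det B = \det (\matrix_(i, j) B (even_ord i) (even_ord j))
          * \det (\matrix_(i, j) B (odd_ord i) (odd_ord j)).
Proof.
move=> B0.
pose f (i : 'I_(M + M)) :=
  match fintype.split i with inl j => even_ord j | inr j => odd_ord j end.
have f_inj : injective f.
  move=> i j; rewrite /f -{2}(fintype.splitK i) -{2}(fintype.splitK j).
  case: (fintype.split i) => i'; case: (fintype.split j) => j' /(congr1 val) /= eq_ij; try lia.
    by congr (unsplit (inl _)); apply: val_inj => /=; lia.
  by congr (unsplit (inr _)); apply: val_inj => /=; lia.
pose s := perm f_inj.
have -> : \det B = \det (row_perm s (col_perm s B)).
  rewrite row_permE col_permE !det_mulmx !det_perm odd_permV.
  by rewrite mulrCA mulrA -mulrA -signr_addb addbb mulr1.
have -> : row_perm s (col_perm s B) =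
    block_mx (\matrix_(i, j) B (even_ord i) (even_ord j)) 0 0
             (\matrix_(i, j) B (odd_ord i) (odd_ord j)).
  apply/matrixP=> i j; rewrite !mxE !permE /f.
  case: (fintype.split i) => i'; rewrite !mxE; case: (fintype.split j) => j'; rewrite !mxE //;
  by rewrite B0 //= !odd_double.
by rewrite det_ublock.
Qed.

Variables (e o : nat -> 'rV[A]_(M + M)).
Hypotheses (e_odd : forall a (k : 'I_(M + M)), odd k -> e a 0 k = 0)
           (o_even : forall a (k : 'I_(M + M)), ~~ odd k -> o a 0 k = 0).

Lemma pmid_odd a (k : 'I_(M + M)) : odd k -> pmid e a 0 k = 0.
Proof.
move=> odd_k; rewrite !mxE /psum summxE big1 ?mulr0 ?add0r ?e_odd // => i _.
by rewrite e_odd.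
Qed.

Lemma nth_index_pairs s i : (i < size s)%N ->
  (index_pairs e o s)`_(i.*2) = pmid e (nth 0%N s i) /\
  (index_pairs e o s)`_(i.*2.+1) = o (nth 0%N s i).
Proof.
by elim: s i => //= a s IH [|i] //=; rewrite ltnS => /IH.
Qed.

Lemma list_det_index_pairs s : size s = M ->
  list_det (index_pairs e o s) =
    \det (\matrix_(i < M, j < M) pmid e (nth 0%N s i) 0 (even_ord j))
    * \det (\matrix_(i < M, j < M) o (nth 0%N s i) 0 (odd_ord j)).
Proof.
move=> size_s; rewrite /list_det size_index_pairs size_s -addnn eqxx.
rewrite det_checkerboard.
  by congr (_ * _); congr (\det _); apply/matrixP=> i j; rewrite !mxE;
     have [] := @nth_index_pairs s i; rewrite ?size_s //= => eq1 eq2; rewrite ?eq1 ?eq2 ?mxE.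
move=> i j; rewrite !mxE.
have [k [ltk]] : exists k, (k < M)%N /\ (i = k.*2 :> nat \/ i = k.*2.+1 :> nat).
  exists (i./2); split; first by have := ltn_ord i; lia.
  by have := odd_double_half i; case: odd => <-; [right | left]; rewrite ?add1n ?doubleK /=; lia.
have [] := @nth_index_pairs s k; rewrite ?size_s // => eq1 eq2 [] ->.
  by rewrite eq1 odd_double eq_sym eqbF_neg negbK; exact: pmid_odd.
by rewrite eq2 /= odd_double eq_sym eqb_id; exact: o_even.
Qed.

(** Andréief's identity: summing a product of two determinants over all [M]-tuples of indices gives
    [M!] times the determinant of the sums of products. *)
Lemma nest_sum_det L :
  nest_sum (@list_det A (M + M)) e o L M [::] =
  M`!%:R * \det (\matrix_(i < M, j < M)
                   \sum_(b < L) pmid e b 0 (even_ord i) * o b 0 (odd_ord j)).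
Proof.
set B := (X in _ * \det X).
pose g (s t : 'S_M) k b := if insub k is Some i
  then pmid e b 0 (even_ord (s i)) * o b 0 (odd_ord (t i)) else 1 : A.
(* The indices in [u] are fixed and fill the places from [p] on; the [p] others are summed
   independently, place by place. *)
have nestE p u : (p + size u)%N = M ->
    nest_sum (@list_det A (M + M)) e o L p u =
    \sum_(s : 'S_M) (-1) ^+ s * \sum_(t : 'S_M) (-1) ^+ t *
      ((\prod_(k < p) \sum_(b < L) g s t k b) *
       \prod_(k < size u) g s t (p + k)%N (nth 0%N u k)).
  elim: p u => [|p IH] u /= defM.
    rewrite list_det_index_pairs // mulr_suml; apply: eq_bigr => s _.
    rewrite -mulrA; congr (_ * _); rewrite mulr_sumr; apply: eq_bigr => t _.
    rewrite mulrCA; congr (_ * _); rewrite big_ord0 mul1r -big_split /= -[size u]add0n defM.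
    by apply: eq_bigr => k _; rewrite /g add0n valK !mxE.
  under eq_bigr do rewrite IH /= ?addnS //.
  rewrite exchange_big; apply: eq_bigr => s _; rewrite -mulr_sumr; congr (_ * _).
  rewrite exchange_big; apply: eq_bigr => t _; rewrite -mulr_sumr; congr (_ * _).
  rewrite -mulr_sumr big_ord_recr -mulrA; congr (_ * _).
  rewrite /= mulr_suml; apply: eq_bigr => b _; rewrite big_ord_recl addn0.
  by congr (_ * _); apply: eq_bigr => k _; rewrite /= /bump /= addnCA addnA.
rewrite nestE ?addn0 //.
(* Permuting the rows of [B] by [s] costs the sign of [s], which is already present, so all [M!]
   terms agree. *)
transitivity (\sum_(s : 'S_M) \det B); last first.
  by rewrite sumr_const card_Sn mulr_natl.
apply: eq_bigr => s _; transitivity ((-1) ^+ s * \det (row_perm s B)); last first.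
  by rewrite row_permE det_mulmx det_perm mulrA -signr_addb addbb mul1r.
congr (_ * _); apply: eq_bigr => t _; congr (_ * _); rewrite big_ord0 mulr1.
by apply: eq_bigr => k _; rewrite !mxE; apply: eq_bigr => b _; rewrite /g valK !mxE.
Qed.

End Checkerboard.

(** * Pairs of subsets as words of signed points *)

Section Subsets.
Local Open Scope fset_scope.
Local Open Scope ring_scope.

Fixpoint subsets_below L : seq {fset nat} :=
  if L is L'.+1 then subsets_below L' ++ [seq L' |` A | A <- subsets_below L']
  else [:: fset0].

Lemma mem_subsets_below L (A : {fset nat}) :
  reflect {in A, forall a, (a < L)%N} (A \in subsets_below L).
Proof.
apply: (iffP idP); elim: L A => [|L IH] A.
- by rewrite inE => /eqP -> a; rewrite inE.
- rewrite mem_cat => /orP[/IH lt_A a /lt_A /leqW //|/mapP[B /IH lt_B ->] a].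
  by rewrite !inE => /orP[/eqP -> //|/lt_B /leqW].
- by move=> A0; rewrite inE; apply/eqP/fsetP => a; rewrite inE; apply/negP => /A0.
move=> lt_A /=; rewrite mem_cat; case: (boolP (L \in A)) => LA.
  apply/orP; right; apply/mapP; exists (A `\ L); last by rewrite fsetD1K.
  apply: IH => a; rewrite !inE => /andP[neq_aL /lt_A].
  by rewrite ltnS leq_eqVlt (negPf neq_aL).
apply/orP; left; apply: IH => a aA; have := lt_A a aA.
by rewrite ltnS leq_eqVlt => /orP[/eqP eq_aL|//]; rewrite -eq_aL aA in LA.
Qed.

Lemma subsets_below_notin L A : A \in subsets_below L -> L \notin A.
Proof. by move/mem_subsets_below=> lt_A; apply/negP => /lt_A; rewrite ltnn. Qed.

Lemma uniq_subsets_below L : uniq (subsets_below L).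
Proof.
elim: L => //= L IH; rewrite cat_uniq IH /=; apply/andP; split.
  apply/hasPn => _ /mapP[A _ ->]; apply/negP => /subsets_below_notin.
  by rewrite !inE eqxx.
rewrite map_inj_in_uniq // => A B /subsets_below_notin LA /subsets_below_notin LB eqAB.
by rewrite -(fsetU1K LA) eqAB fsetU1K.
Qed.

(* The points of the symbol [(A, B)] by increasing absolute value, those of [B]
   carrying a minus sign. *)
Fixpoint points L (A B : {fset nat}) : seq (bool * nat) :=
  if L is L'.+1 then
    points L' A B ++ (if L' \in B then [:: (true, L')] else [::])
                  ++ (if L' \in A then [:: (false, L')] else [::])
  else [::].

Lemma eq_points L A B A' B' :
    (forall a, (a < L)%N -> (a \in A) = (a \in A')) ->
    (forall a, (a < L)%N -> (a \in B) = (a \in B')) ->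
  points L A B = points L A' B'.
Proof.
elim: L => //= L IH eqA eqB; rewrite eqA // eqB // IH // => a ltaL.
  by rewrite eqA // ltnW.
by rewrite eqB // ltnW.
Qed.

Lemma points_fset1Ul L A B : points L (L |` A) B = points L A B.
Proof. by apply: eq_points => // a lt_a; rewrite !inE (ltn_eqF lt_a). Qed.

Lemma points_fset1Ur L A B : points L A (L |` B) = points L A B.
Proof. by apply: eq_points => // a lt_a; rewrite !inE (ltn_eqF lt_a). Qed.

(** The four terms of [word_sum] are the four ways in which the top index can lie in [A] and in
    [B]. *)
Lemma word_sum_points (T : comNzRingType) (g : seq (bool * nat) -> T) L t :
  \sum_(A <- subsets_below L) \sum_(B <- subsets_below L) g (points L A B ++ t)
  = word_sum g L t.
Proof.
elim: L t => [|L IH] t /=; first by rewrite !big_seq1.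
rewrite big_cat big_map /= -!IH.
have split4 A : A \in subsets_below L ->
  (\sum_(B <- subsets_below L ++ [seq L |` A | A <- subsets_below L])
     g (points L.+1 A B ++ t)
   = \sum_(B <- subsets_below L) g (points L A B ++ t)
     + \sum_(B <- subsets_below L) g (points L A B ++ (true, L) :: t)) /\
  (\sum_(B <- subsets_below L ++ [seq L |` A | A <- subsets_below L])
     g (points L.+1 (L |` A) B ++ t)
   = \sum_(B <- subsets_below L) g (points L A B ++ (false, L) :: t)
     + \sum_(B <- subsets_below L) g (points L A B ++ [:: (true, L), (false, L) & t])).
  move=> /subsets_below_notin LA; rewrite !big_cat !big_map /=; split;
  congr (_ + _); rewrite !big_seq; apply: eq_bigr => B /subsets_below_notin LB;
  by rewrite ?inE ?eqxx ?(negPf LA) ?(negPf LB) ?points_fset1Ul ?points_fset1Ur ?cats0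
     -?catA.
rewrite -!big_split /=; apply: eq_big_seq => A /split4[].
by rewrite /= => -> ->; rewrite !addrA.
Qed.

Lemma big_points (T : Type) (idx : T) (op : Monoid.com_law idx) L A B (G : bool * nat -> T) :
    A \in subsets_below L -> B \in subsets_below L ->
  \big[op/idx]_(x <- points L A B) G x =
  op (\big[op/idx]_(a <- A) G (false, a)) (\big[op/idx]_(b <- B) G (true, b)).
Proof.
elim: L A B => [|L IH] A B.
  by rewrite !inE => /eqP -> /eqP ->; rewrite !big_nil Monoid.mul1m.
rewrite /= !mem_cat => /orP[inA|/mapP[A' inA ->]] /orP[inB|/mapP[B' inB ->]];
  rewrite ?points_fset1Ul ?points_fset1Ur ?inE ?eqxx ?(negPf (subsets_below_notin inA))
    ?(negPf (subsets_below_notin inB)) /= ?cats0 ?big_cat ?big_cat ?big_cons ?big_nil /=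
    ?big_fsetU1 ?subsets_below_notin //= ?IH // ?Monoid.mulm1.
- by rewrite -Monoid.mulmA; congr (op _ _); apply: Monoid.mulmC.
- by rewrite Monoid.mulmC Monoid.mulmA.
rewrite [op (G (true, L)) (G _)]Monoid.mulmC Monoid.mulmACA.
by congr (op _ _); apply: Monoid.mulmC.
Qed.

End Subsets.

(** * The numerator of delta as a Vandermonde product *)

Section SymbolProduct.
Local Open Scope fset_scope.
Local Open Scope ring_scope.
Variables (T : comNzRingType) (q : T).

Definition symbol_prod (A B : {fset nat}) : T :=
  (\prod_(a <- A) \prod_(b <- A | (a < b)%N) (q ^+ b - q ^+ a))
  * (\prod_(a <- B) \prod_(b <- B | (a < b)%N) (q ^+ b - q ^+ a))
  * (\prod_(a <- A) \prod_(b <- B) (q ^+ a + q ^+ b)).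

Definition point_val (x : bool * nat) : T := (-1) ^+ x.1 * q ^+ x.2.

(** The sign of the later point makes this the distance of the two points when [q > 1] and [x]
    precedes [y] in [points]. *)
Definition point_dist (x y : bool * nat) : T := (-1) ^+ y.1 * (point_val y - point_val x).

Fixpoint dist_prod (s : seq (bool * nat)) : T :=
  if s is x :: t then (\prod_(y <- t) point_dist x y) * dist_prod t else 1.

Fixpoint diff_prod (s : seq T) : T :=
  if s is x :: t then (\prod_(y <- t) (y - x)) * diff_prod t else 1.

Lemma dist_prod_rcons s y :
  dist_prod (rcons s y) = dist_prod s * \prod_(x <- s) point_dist x y.
Proof.
elim: s => [|x s IH] /=; first by rewrite !big_nil mulr1.
by rewrite big_rcons IH big_cons /=; ring.
Qed.

Lemma big_pairs_fsetU1 L A : A \in subsets_below L ->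
  \prod_(a <- L |` A) \prod_(b <- L |` A | (a < b)%N) (q ^+ b - q ^+ a) =
  (\prod_(a <- A) \prod_(b <- A | (a < b)%N) (q ^+ b - q ^+ a))
  * \prod_(a <- A) (q ^+ L - q ^+ a).
Proof.
move=> inA; have LA := subsets_below_notin inA; move/mem_subsets_below in inA.
rewrite big_fsetU1 //= big_seq_cond big1 ?mul1r; last first.
  move=> b; rewrite !inE => /andP[/orP[/eqP ->|/inA ltbL]]; first by rewrite ltnn.
  by move/(ltn_trans ltbL); rewrite ltnn.
rewrite -big_split /=; apply: eq_big_seq => a aA.
by rewrite big_mkcond big_fsetU1 //= inA // -big_mkcond mulrC.
Qed.

Lemma symbol_prodE L A B : A \in subsets_below L -> B \in subsets_below L ->
  symbol_prod A B = dist_prod (points L A B).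
Proof.
elim: L A B => [|L IH] A B.
  by rewrite !inE => /eqP -> /eqP ->; rewrite /symbol_prod !big_nil !mulr1.
have addA A' B' : A' \in subsets_below L -> B' \in subsets_below L ->
    symbol_prod (L |` A') B' =
    symbol_prod A' B' * \prod_(x <- points L A' B') point_dist x (false, L).
  move=> inA inB; rewrite /symbol_prod big_pairs_fsetU1 // big_points //=.
  rewrite big_fsetU1 ?subsets_below_notin //= /point_dist /point_val /=.
  under [X in _ = _ * (X * _)]eq_bigr do rewrite !expr0 !mul1r.
  under [X in _ = _ * (_ * X)]eq_bigr do rewrite !expr0 !expr1 !mul1r mulN1r opprK.
  by ring.
have addB A' B' : A' \in subsets_below L -> B' \in subsets_below L ->
    symbol_prod A' (L |` B') =
    symbol_prod A' B' * \prod_(x <- points L A' B') point_dist x (true, L).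
  move=> inA inB; rewrite /symbol_prod big_pairs_fsetU1 // big_points //=.
  under [X in _ * X]eq_bigr do rewrite big_fsetU1 ?subsets_below_notin //=.
  rewrite big_split /= /point_dist /point_val /=.
  under [X in _ = _ * (X * _)]eq_bigr do
    rewrite !expr0 !expr1 mul1r !mulN1r opprB opprK.
  under [X in _ = _ * (_ * X)]eq_bigr do rewrite !expr1 !mulN1r opprB opprK addrC.
  by ring.
have addAB A' B' : A' \in subsets_below L -> B' \in subsets_below L ->
    symbol_prod (L |` A') (L |` B') =
    symbol_prod A' (L |` B') * \prod_(x <- points L A' B') point_dist x (false, L)
    * point_dist (true, L) (false, L).
  move=> inA inB; rewrite /symbol_prod [X in X * _ * _]big_pairs_fsetU1 // big_points //=.
  rewrite [X in _ * X]big_fsetU1 ?subsets_below_notin //=.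
  rewrite [X in _ * (X * _)]big_fsetU1 ?subsets_below_notin //=.
  rewrite /point_dist /point_val /=.
  under [X in _ = _ * (X * _) * _]eq_bigr do rewrite !expr0 !mul1r.
  under [X in _ = _ * (_ * X) * _]eq_bigr do rewrite !expr0 !expr1 !mul1r mulN1r opprK.
  by rewrite expr0 expr1; ring.
rewrite /= !mem_cat => /orP[inA|/mapP[A' inA ->]] /orP[inB|/mapP[B' inB ->]];
  rewrite ?addAB ?addA ?addB // ?points_fset1Ul ?points_fset1Ur ?inE ?eqxx
    ?(negPf (subsets_below_notin inA)) ?(negPf (subsets_below_notin inB)) /= ?cats0
    ?cats1 ?dist_prod_rcons -?IH //.
rewrite -[points L A' B' ++ _]/(points L A' B' ++ [:: (true, L)] ++ [:: (false, L)]).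
by rewrite catA !cats1 !dist_prod_rcons big_rcons -IH //=; ring.
Qed.

Lemma sign_prod_sqr (s : seq (bool * nat)) :
  (\prod_(x <- s) (-1) ^+ x.1 : T) * \prod_(x <- s) (-1) ^+ x.1 = 1.
Proof. by rewrite -big_split big1 //= => x _; rewrite -signr_addb addbb. Qed.

(** The sign of a point enters once for each earlier point, so it survives exactly at odd positions.
    In a list of odd length [alt_sign] sees the opposite parity, which the product of all signs
    corrects. *)
Lemma dist_prod_diff_prod s : dist_prod s =
  alt_sign T s * (if odd (size s) then \prod_(x <- s) (-1) ^+ x.1 else 1)
  * diff_prod (map point_val s).
Proof.
elim: s => [|x s IH] /=; first by rewrite !mul1r.
rewrite IH big_map /point_dist big_split /= big_cons.
have sgs := sign_prod_sqr s; have sgx : ((-1) ^+ x.1 : T) * (-1) ^+ x.1 = 1.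
  by rewrite -signr_addb addbb.
set S := \prod_(y <- s) (-1) ^+ y.1 in sgs *.
set P := \prod_(y <- s) _; set D := diff_prod _; set a := alt_sign _ s.
case: odd => /=.
  transitivity ((S * S) * a * P * D); first by ring.
  by rewrite sgs; ring.
by transitivity ((-1) ^+ x.1 * (-1) ^+ x.1 * (S * a * P * D)); [rewrite sgx | ]; ring.
Qed.

End SymbolProduct.

(** * Vandermonde determinants in a basis of monic polynomials *)

Section MonicVandermonde.
Variables (T : comNzRingType).

Lemma diff_prodE (s : seq T) :
  diff_prod s = \prod_(i < size s) \prod_(j < size s | (i < j)%N) (s`_j - s`_i).
Proof.
elim: s => [|x s IH] /=; first by rewrite big_ord0.
rewrite big_ord_recl [X in _ = X * _]big_mkcond [X in _ = X * _]big_ord_recl /= mul1r.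
congr (_ * _).
  by rewrite (big_nth 0) big_mkord.
rewrite IH; apply: eq_bigr => i _; rewrite [RHS]big_mkcond big_ord_recl /= mul1r.
by rewrite -big_mkcond; apply: eq_bigl.
Qed.

Lemma det_monic_Vandermonde (p : nat -> {poly T}) (s : seq T) :
    (forall k, p k \is monic) -> (forall k, size (p k) = k.+1) ->
  \det (\matrix_(i < size s, k < size s) (p k).[s`_i]) = diff_prod s.
Proof.
move=> p_monic size_p; set n := size s.
pose U : 'M[T]_n := \matrix_(k, l) (p k)`_l.
have -> : \matrix_(i < n, k < n) (p k).[s`_i] =
    (U *m Vandermonde n (\row_(i < n) s`_i))^T.
  apply/matrixP=> i k; rewrite !mxE (@horner_coef_wide _ n) ?size_p //.
  by apply: eq_bigr => l _; rewrite !mxE.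
rewrite det_tr det_mulmx det_Vandermonde det_trig.
  rewrite big1 => [|i _].
    by rewrite mul1r diff_prodE; do 2!apply: eq_bigr => ? _; rewrite !mxE.
  by have /monicP := p_monic i; rewrite mxE lead_coefE size_p.
by apply/is_trig_mxP => i j ltij; rewrite mxE nth_default // size_p.
Qed.

End MonicVandermonde.

(** * Reduction of the sum over symbols to a Toeplitz determinant *)

Section SymbolSum.
Local Open Scope fset_scope.
Local Open Scope ring_scope.
Variables (R : realFieldType) (q : R) (u : nat -> R) (M : nat).

(** The variable ['X] records the sum of the entries, that is, the rank up to a constant depending
    on [M]. *)
Definition weight a : {poly R} := (u a)%:P * 'X^a.

(* Even-odd Newton polynomials with nodes at the points [+-q^i]. *)
Definition newton k : {poly {poly R}} :=
  'X^(odd k) * \prod_(i < k./2) ('X^2 - (q%:P ^+ (2 * i))%:P).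

Lemma monic_newton k : newton k \is monic.
Proof.
rewrite rpredM ?monicXn // rpred_prod // => i _; exact: monicXnsubC.
Qed.

Lemma size_newton k : size (newton k) = k.+1.
Proof.
rewrite /newton size_monicM ?monicXn //; last first.
  by rewrite monic_neq0 // rpred_prod // => i _; exact: monicXnsubC.
rewrite size_polyXn addSn /= -[in RHS](odd_double_half k) -addnS; congr (_ + _)%N.
elim: (k./2) => [|n IH]; first by rewrite big_ord0 size_poly1.
rewrite big_ord_recr /= size_Mmonic ?monicXnsubC //; last first.
  by rewrite monic_neq0 // rpred_prod // => i _; exact: monicXnsubC.
by rewrite IH size_XnsubC // doubleS !addnS addn0.
Qed.

Lemma newton_sign k (b : bool) (s : {poly R}) :
  (newton k).[(-1) ^+ b * s] = (-1) ^+ (b && odd k) * (newton k).[s].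
Proof.
rewrite /newton !hornerM !horner_prod !hornerXn mulrA exprMn -exprM mulnb.
by congr (_ * _); apply: eq_bigr => i _; rewrite !hornerE exprMn sqrr_sign mul1r.
Qed.

(** Since [newton k] has the parity of [k], negating the point [q^a] flips exactly the odd columns
    of its row; these two vectors are the two parts. *)
Definition even_vec a : 'rV[{poly R}]_(M + M) :=
  \row_k (if odd k then 0 else weight a * (newton k).[q%:P ^+ a]).
Definition odd_vec a : 'rV[{poly R}]_(M + M) :=
  \row_k (if odd k then weight a * (newton k).[q%:P ^+ a] else 0).

Lemma signed_vecE x k : signed_vec even_vec odd_vec x 0 k =
  weight x.2 * (newton k).[point_val q%:P x].
Proof.
rewrite !mxE /point_val newton_sign; case: odd; rewrite ?andbT ?andbF.
  by rewrite add0r mulrCA.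
by rewrite mulr0 addr0 mul1r.
Qed.

Lemma list_det_points s : size s = (M + M)%N ->
  alt_sign _ s * list_det (map (signed_vec even_vec odd_vec) s) =
  \prod_(x <- s) weight x.2 * dist_prod q%:P s.
Proof.
move=> size_s; rewrite /list_det size_map size_s eqxx dist_prod_diff_prod.
rewrite size_s oddD addbb mulr1 mulrCA; congr (_ * _).
have size_v : size (map (point_val q%:P) s) = (M + M)%N by rewrite size_map.
rewrite -(det_monic_Vandermonde _ monic_newton size_newton) size_v.
set D := \matrix_(i, k) (_).[_].
have -> : \prod_(x <- s) weight x.2 =
    \det (diag_mx (\row_(i < M + M) weight (nth (false, 0%N) s i).2)).
  rewrite det_diag (big_nth (false, 0%N)) big_mkord size_s.
  by apply: eq_bigr => i _; rewrite mxE.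
rewrite -det_mulmx; congr (\det _); apply/matrixP=> i k; rewrite mul_diag_mx !mxE.
rewrite (nth_map (false, 0%N)) ?size_s // signed_vecE.
by rewrite (nth_map (false, 0%N)) ?size_s.
Qed.

Definition pair_mx L : 'M[{poly R}]_M :=
  \matrix_(i, j) \sum_(b < L) pmid even_vec b 0 (even_ord i) * odd_vec b 0 (odd_ord j).

Lemma symbol_sum_pair_mx L :
  \sum_(A <- subsets_below L) \sum_(B <- subsets_below L | (#|` A| + #|` B| == M + M)%N)
    symbol_prod q%:P A B * (\prod_(a <- A) weight a * \prod_(b <- B) weight b)
  = 2 ^+ M * \det (pair_mx L).
Proof.
pose f := @list_det {poly R} (M + M).
pose v := signed_vec even_vec odd_vec.
transitivity (word_sum (fun s => alt_sign _ s * f (map v s)) L [::]).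
  rewrite -word_sum_points; apply: eq_big_seq => A inA; rewrite big_mkcond.
  apply: eq_big_seq => B inB; rewrite cats0.
  have size_p : size (points L A B) = (#|` A| + #|` B|)%N.
    by rewrite -sum1_size (big_points _ _ inA inB) /= !sum1_size.
  case: eqP => [eqN|neqN].
    rewrite (symbol_prodE _ inA inB) list_det_points ?size_p // mulrC.
    by rewrite (big_points _ _ inA inB).
  by rewrite /f list_det_size ?mulr0 // size_map size_p; apply/eqP.
have f_size t : size t != (M + M)%N -> f t = 0 by exact: list_det_size.
have evenN : ~~ odd (M + M) by rewrite oddD addbb.
have f_alt : alternating f := @alternating_list_det _ _.
rewrite (word_sum_pair_sum f_alt even_vec odd_vec evenN f_size) /= mul1r.
have e_odd a (k : 'I_(M + M)) : odd k -> even_vec a 0 k = 0.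
  by rewrite mxE => ->.
have o_even a (k : 'I_(M + M)) : ~~ odd k -> odd_vec a 0 k = 0.
  by rewrite mxE => /negPf ->.
have := @pair_sum_nest_sum _ _ f f_alt even_vec odd_vec _ f_size L M [::].
rewrite addn0 -addnn => /(_ erefl).
rewrite (nest_sum_det e_odd o_even) mulrCA.
apply: mulfI; rewrite -polyC_natr polyC_eq0 pnatr_eq0 -lt0n; exact: fact_gt0.
Qed.

(** The coefficients of [(1 + t) / (1 - t)]. *)
Definition toep_c (d : nat) : R := if d == 0%N then 1 else 2.

(* Coefficients in [t] of [(1 + t) / (1 - t) * sum_a u_a (X t)^a]. *)
Definition toep_up d : {poly R} := \sum_(a < d.+1) (toep_c (d - a) * u a)%:P * 'X^a.

(** The coefficients in [t^(-1)] of the second factor [sum_b u_b (q X / t)^b] of the symbol. *)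
Definition toep_low b : {poly R} := (u b * q ^+ b)%:P * 'X^b.

(** An upper times a lower triangular Toeplitz matrix, cut at [L]. Without the cut, entry [(i, j)]
    would be the coefficient of [t^(j-i)] in the symbol. *)
Definition toep_mx L : 'M[{poly R}]_M :=
  \matrix_(i, j) \sum_(k < L)
    (if (i <= k)%N then toep_up (k - i) else 0)
    * (if (j <= k)%N then toep_low (k - j) else 0).

Hypothesis u_rec : forall a, u a.+1 * (q ^+ (2 * a.+1) - 1) = u a.

(** Write [q^(2a) - q^(2i) = q^(2i) (q^(2(a-i)) - 1)]: by [u_rec] the last factor lowers the index
    of [u] by one. Up to row and column scalings only differences of indices remain, which is the
    source of the Toeplitz shape. *)
Lemma weight_newton i a :
  u a * \prod_(k < i) (q ^+ (2 * a) - q ^+ (2 * k)) =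
  if (i <= a)%N then q ^+ (i * i.-1) * u (a - i) else 0.
Proof.
elim: i => [|i IH]; first by rewrite big_ord0 subn0 mul1r mulr1.
rewrite big_ord_recr mulrA {}IH.
case: (ltngtP i a) => [lt_ia|lt_ai|->]; last 2 first.
- by rewrite mul0r.
- by rewrite subrr mulr0.
have ur := u_rec (a - i.+1); rewrite subnSK // in ur; rewrite -ur.
have -> : q ^+ (2 * a) = q ^+ (2 * i) * q ^+ (2 * (a - i)).
  by rewrite -exprD -mulnDr subnKC // ltnW.
have -> : (i.+1 * i.+1.-1 = i * i.-1 + 2 * i)%N by case: (i) => //= j; lia.
by rewrite exprD; ring.
Qed.

Lemma newton_even i a : (newton i.*2).[q%:P ^+ a] =
  (\prod_(k < i) (q ^+ (2 * a) - q ^+ (2 * k)))%:P.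
Proof.
rewrite /newton odd_double doubleK mul1r horner_prod rmorph_prod.
apply: eq_bigr => k _; rewrite !hornerE -exprM mulnC.
by rewrite rmorphB !rmorphXn.
Qed.

Lemma newton_odd i a : (newton i.*2.+1).[q%:P ^+ a] =
  (q ^+ a * \prod_(k < i) (q ^+ (2 * a) - q ^+ (2 * k)))%:P.
Proof.
rewrite polyCM polyC_exp -newton_even /newton /= odd_double uphalf_double doubleK.
by rewrite mul1r hornerM hornerX.
Qed.

Lemma even_vecE a i : even_vec a 0 (even_ord i) =
  (q ^+ (i * i.-1))%:P * 'X^i * (if (i <= a)%N then (u (a - i))%:P * 'X^(a - i) else 0).
Proof.
rewrite mxE /= odd_double newton_even /weight mulrAC -polyCM weight_newton.
case: leqP => [le_ia|_]; last by rewrite mulr0 mul0r.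
have -> : 'X^a = 'X^i * 'X^(a - i) :> {poly R} by rewrite -exprD subnKC.
by rewrite polyCM; ring.
Qed.

Lemma odd_vecE a j : odd_vec a 0 (odd_ord j) =
  (q ^+ (j * j.-1 + j))%:P * 'X^j * (if (j <= a)%N then toep_low (a - j) else 0).
Proof.
rewrite mxE /= odd_double newton_odd /weight mulrAC -polyCM mulrCA weight_newton.
case: leqP => [le_ja|_]; last by rewrite !mulr0 mul0r.
have -> : 'X^a = 'X^j * 'X^(a - j) :> {poly R} by rewrite -exprD subnKC.
have -> : q ^+ a = q ^+ j * q ^+ (a - j) by rewrite -exprD subnKC.
by rewrite exprD /toep_low !polyCM; ring.
Qed.

Lemma pmid_even_vec b i : pmid even_vec b 0 (even_ord i) =
  (q ^+ (i * i.-1))%:P * 'X^i * (if (i <= b)%N then toep_up (b - i) else 0).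
Proof.
have -> : pmid even_vec b 0 (even_ord i) =
    \sum_(0 <= a < b.+1) (toep_c (b - a))%:P * even_vec a 0 (even_ord i).
  rewrite big_mkord big_ord_recr /= subnn mul1r mxE; congr (_ + _).
  rewrite mxE /psum summxE mulr_sumr; apply: eq_bigr => a _.
  by rewrite /toep_c subn_eq0 leqNgt ltn_ord polyC_natr.
under eq_bigr do rewrite even_vecE mulrCA.
rewrite -mulr_sumr; congr (_ * _); case: leqP => [le_ib|lt_bi]; last first.
  rewrite big_nat_cond big1 // => a /andP[/andP[_ le_ab] _].
  by rewrite leqNgt (leq_trans _ lt_bi) // mulr0.
rewrite (@big_cat_nat _ _ _ i) ?leqW //= big_nat_cond big1 ?add0r; last first.
  by move=> a /andP[/andP[_ lt_ai] _]; rewrite leqNgt lt_ai mulr0.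
rewrite -{1}(add0n i) big_addn big_mkord subSn // /toep_up; apply: eq_bigr => a _.
by rewrite leq_addl addnK polyCM mulrA subnDA subnAC.
Qed.

(** The row and column scalings come out: ['X^(M * M.-1)] is the constant subtracted in the rank of
    a symbol with [2M] entries, and the power of [q] is the one in the denominator of [delta]. *)
Lemma det_pair_mx L : \det (pair_mx L) =
  (q ^+ (\sum_(i < M) (i * i.-1 + (i * i.-1 + i))))%:P * 'X^(M * M.-1) * \det (toep_mx L).
Proof.
pose r := \row_(i < M) ((q ^+ (i * i.-1))%:P * 'X^i).
pose s := \row_(i < M) ((q ^+ (i * i.-1 + i))%:P * 'X^i).
have -> : pair_mx L = diag_mx r *m toep_mx L *m diag_mx s.
  apply/matrixP=> i j; rewrite mul_mx_diag mul_diag_mx !mxE mulr_sumr mulr_suml.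
  by apply: eq_bigr => b _; rewrite pmid_even_vec odd_vecE; ring.
rewrite !det_mulmx !det_diag mulrAC -big_split /=; congr (_ * _).
have -> : (M * M.-1 = \sum_(i < M) (i + i))%N.
  elim: (M) => [|m IH]; first by rewrite big_ord0.
  by rewrite big_ord_recr -IH; case: m {IH} => //= m; lia.
rewrite !expr_sum rmorph_prod -big_split /=; apply: eq_bigr => i _.
by rewrite !mxE !exprD !polyCM; ring.
Qed.

End SymbolSum.

(** * Congruence of polynomials modulo a power of X *)

Section TruncatedEquality.
Variable R : nzRingType.
Implicit Types (p r : {poly R}) (n : nat).

Definition eqmodX n p r := forall i, (i < n)%N -> p`_i = r`_i.

Lemma eqmodX_refl n p : eqmodX n p p. Proof. by []. Qed.

Lemma eqmodX_sym n p r : eqmodX n p r -> eqmodX n r p.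
Proof. by move=> eq_pr i /eq_pr. Qed.

Lemma eqmodX_trans n p r s : eqmodX n p r -> eqmodX n r s -> eqmodX n p s.
Proof. by move=> eq_pr eq_rs i lt_in; rewrite eq_pr ?eq_rs. Qed.

Lemma eqmodXD n p r p' r' :
  eqmodX n p r -> eqmodX n p' r' -> eqmodX n (p + p') (r + r').
Proof. by move=> eq1 eq2 i lt_in; rewrite !coefD eq1 ?eq2. Qed.

Lemma eqmodXM n p r p' r' :
  eqmodX n p r -> eqmodX n p' r' -> eqmodX n (p * p') (r * r').
Proof.
move=> eq1 eq2 i lt_in; rewrite !coefM; apply: eq_bigr => j _.
by rewrite eq1 ?eq2 //; have := ltn_ord j; lia.
Qed.

Lemma eqmodX_sum n I (s : seq I) (P : pred I) (F G : I -> {poly R}) :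
    (forall i, P i -> eqmodX n (F i) (G i)) ->
  eqmodX n (\sum_(i <- s | P i) F i) (\sum_(i <- s | P i) G i).
Proof.
move=> eqFG; apply: (big_ind2 (eqmodX n)) => // p1 r1 p2 r2; exact: eqmodXD.
Qed.

Lemma eqmodX_prod n I (s : seq I) (P : pred I) (F G : I -> {poly R}) :
    (forall i, P i -> eqmodX n (F i) (G i)) ->
  eqmodX n (\prod_(i <- s | P i) F i) (\prod_(i <- s | P i) G i).
Proof.
move=> eqFG; apply: (big_ind2 (eqmodX n)) => // p1 r1 p2 r2; exact: eqmodXM.
Qed.

Lemma eqmodX_mulXn n k p : (n <= k)%N -> eqmodX n (p * 'X^k) 0.
Proof. by move=> le_nk i lt_in; rewrite coefMXn (leq_trans lt_in le_nk) coef0. Qed.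

End TruncatedEquality.

Lemma eqmodX_det (R : comNzRingType) n m (A B : 'M[{poly R}]_m) :
  (forall i j, eqmodX n (A i j) (B i j)) -> eqmodX n (\det A) (\det B).
Proof.
move=> eqAB; apply: eqmodX_sum => s _; apply: eqmodXM => //.
by apply: eqmodX_prod => i _.
Qed.

Section SymbolEvaluation.
Variables (R : realFieldType) (u : nat -> R).

Lemma toep_upS d :
  toep_up u d.+1 = toep_up u d + (u d)%:P * 'X^d + (u d.+1)%:P * 'X^(d.+1).
Proof.
rewrite /toep_up big_ord_recr /= subnn {2}/toep_c eqxx mul1r; congr (_ + _).
rewrite big_ord_recr [X in _ = X + _]big_ord_recr /= -addrA; congr (_ + _).
  apply: eq_bigr => a _; congr (_%:P * _); congr (_ * _).
  have lt_ad := ltn_ord a; rewrite /toep_c.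
  have -> : (d.+1 - a == 0)%N = false by lia.
  by have -> : (d - a == 0)%N = false by lia.
by rewrite subnn subSnn /toep_c /= -mulrDl -polyCD; congr (_%:P * _); ring.
Qed.

(** Multiplying by [1 - y] clears the denominator of [(1 + t) / (1 - t)] at [t = y]; the last term
    is the boundary term of the cut. *)
Lemma toep_up_eval (y : {poly R}) K :
  (1 - y) * \sum_(d < K.+1) toep_up u d * y ^+ d =
  (1 + y) * \sum_(d < K.+1) (u d)%:P * ('X * y) ^+ d
  - (toep_up u K + (u K)%:P * 'X^K) * y ^+ K.+1.
Proof.
elim: K => [|K IH].
  rewrite !big_ord1 /toep_up big_ord1 /toep_c /= !expr0 !mulr1 mul1r expr1; ring.
rewrite big_ord_recr [in RHS]big_ord_recr /= !mulrDr IH toep_upS exprMn !(exprS y).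
by ring.
Qed.

End SymbolEvaluation.

(** * Evaluation of the Toeplitz determinant for finite products *)

Section FiniteToeplitz.
Variables (R : realFieldType) (q : R).
Hypothesis q_gt1 : 1 < q.

(** By [qbinomial], the coefficient of [s^a] in the product of [1 + s q^(-2i)] over [1 <= i <= m];
    in particular 0 for [a > m]. *)
Definition qbin_coef m a : R :=
  \prod_(j < a) ((1 - q ^- (2 * (m - j))) / (q ^+ (2 * j.+1) - 1)).

Lemma q_neq0 : q != 0. Proof. by rewrite gt_eqF // (lt_trans ltr01). Qed.

Lemma qX_sub1_neq0 n : (0 < n)%N -> q ^+ n - 1 != 0.
Proof. by move=> n_gt0; rewrite subr_eq0 gt_eqF // exprn_egt1 // -lt0n. Qed.

Lemma qbin_coef_gt m a : (m < a)%N -> qbin_coef m a = 0.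
Proof.
move=> lt_ma; rewrite /qbin_coef (bigD1 (Ordinal lt_ma)) //=.
by rewrite subnn invr1 subrr !mul0r.
Qed.

Lemma qbin_coefS m a :
  qbin_coef m.+1 a.+1 = qbin_coef m a.+1 + q ^- (2 * m.+1) * qbin_coef m a.
Proof.
case: (ltnP m a) => [lt_ma|le_am].
  by rewrite (qbin_coef_gt (leqW lt_ma)) (qbin_coef_gt lt_ma) qbin_coef_gt // mulr0 addr0.
have -> : qbin_coef m.+1 a.+1 =
    (1 - q ^- (2 * m.+1)) / (q ^+ (2 * a.+1) - 1) * qbin_coef m a.
  rewrite /qbin_coef !prodf_div big_ord_recl /= subn0 [X in _ / X]big_ord_recr /=.
  rewrite invfM.
  have -> : \prod_(i < a) (1 - q ^- (2 * (m.+1 - bump 0 i))) =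
      \prod_(i < a) (1 - q ^- (2 * (m - i))).
    by apply: eq_bigr => i _; rewrite /bump add1n subSS.
  by ring.
have -> : qbin_coef m a.+1 =
    (1 - q ^- (2 * (m - a))) / (q ^+ (2 * a.+1) - 1) * qbin_coef m a.
  by rewrite /qbin_coef big_ord_recr /= [LHS]mulrC.
have -> : q ^- (2 * (m - a)) = q ^- (2 * m.+1) * q ^+ (2 * a.+1).
  rewrite -[m.+1](subnKC (_ : a.+1 <= m.+1)%N) // subSS mulnDr exprD invfM.
  by rewrite mulrAC mulVf ?mul1r // expf_neq0 ?q_neq0.
have := qX_sub1_neq0 (ltn0Sn (2 * a.+1).-1).
have -> : ((2 * a.+1).-1.+1 = 2 * a.+1)%N by lia.
set X := q ^+ (2 * a.+1); set Y := q ^- _; set B := qbin_coef m a => nz.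
by field.
Qed.

(** The q-binomial theorem in base [q^(-2)], homogeneous in [al] and [y]; the induction rests on the
    Pascal rule [qbin_coefS]. *)
Lemma qbinomial m (al y : {poly R}) :
  \sum_(a < m.+1) (qbin_coef m a)%:P * al ^+ a * y ^+ (m - a) =
  \prod_(i < m) (y + (q ^- (2 * i.+1))%:P * al).
Proof.
elim: m => [|m IH].
  by rewrite big_ord1 !big_ord0 /qbin_coef big_ord0 !mulr1.
rewrite [RHS]big_ord_recr -IH /= mulrDr {IH}.
rewrite big_ord_recl /= [X in _ = X * _ + _]big_ord_recl /=.
have q0 k : qbin_coef k 0 = 1 by rewrite /qbin_coef big_ord0.
rewrite !q0 !subn0 !expr0 !mul1r.
under eq_bigr do rewrite /bump /= !add1n qbin_coefS subSS polyCD !mulrDl.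
rewrite big_split /= addrA mulrDl -exprSr; congr (_ + _ + _).
  rewrite big_ord_recr /= qbin_coef_gt // !mul0r addr0 mulr_suml.
  apply: eq_bigr => i _; rewrite /bump /= add1n.
  have -> : (m - i = (m - i.+1).+1)%N by have := ltn_ord i; lia.
  by rewrite !exprS; ring.
rewrite mulr_suml; apply: eq_bigr => i _.
by rewrite polyCM exprS; ring.
Qed.

Section Evaluation.
Variables (M m : nat).
Let u := qbin_coef m.
Let K := (M + m)%N.

(** With [i = j + 1], the factor [1 + X t^(-1) q^(1-2i)] of the symbol vanishes at
    [t = toep_pole j * X]. *)
Definition toep_pole (j : nat) : R := - (q / q ^+ (2 * j.+1)).
Let y (j : nat) : {poly R} := (toep_pole j)%:P * 'X.

Definition up_val (j : nat) : {poly R} := \sum_(d < K) toep_up u d * y j ^+ d.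

Let Up : 'M[{poly R}]_(M + m) :=
  \matrix_(i, k) if (i <= k)%N then toep_up u (k - i) else 0.
Let Low : 'M[{poly R}]_(M + m, M) :=
  \matrix_(k, j) if (j <= k)%N then toep_low q u (k - j) else 0.
(* Row [j] of [Ev] annihilates the columns of [Low] and is, modulo [X^K], a left
   eigenvector of [Up] for the eigenvalue [up_val j]. *)
Let Ev : 'M[{poly R}]_(m, M + m) := \matrix_(j, k) y j ^+ (K.-1 - k).
Let W0 : 'M[R]_m := \matrix_(j, i) toep_pole j ^+ (m.-1 - i).

Lemma toep_poleE j : y j + (q ^- (2 * j.+1))%:P * (q%:P * 'X) = 0.
Proof.
by rewrite /y /toep_pole mulrA -polyCM -mulrDl -polyCD (mulrC q) addNr mul0r.
Qed.

(** Column [i] of [Low] lives in rows [i] to [i + m], all present because [i < M]. Pairing it with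
    row [j] of [Ev] gives a power of [y j] times the lower factor of the symbol, cleared of
    denominators, at its zero. *)
Lemma Ev_Low : Ev *m Low = 0.
Proof.
apply/matrixP=> j i; rewrite !mxE.
have low0 b : (m < b)%N -> toep_low q u b = 0.
  by move=> lt_mb; rewrite /toep_low /u qbin_coef_gt // !mul0r.
under eq_bigr do rewrite !mxE.
have lt_iM := ltn_ord i.
rewrite -(big_mkord xpredT (fun k => y j ^+ (K.-1 - k) *
   (if (i <= k)%N then toep_low q u (k - i) else 0))).
rewrite (@big_cat_nat _ _ _ i) //=; last by lia.
rewrite big_nat_cond big1 ?add0r; last first.
  by move=> k /andP[/andP[_ lt_ki] _]; rewrite leqNgt lt_ki mulr0.
rewrite (@big_cat_nat _ _ _ (i + m.+1)%N) //=; [|lia..].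
rewrite [X in _ + X]big_nat_cond [X in _ + X]big1 ?addr0; last first.
  by move=> k /andP[/andP[le_k _] _]; rewrite low0 ?if_same ?mulr0 //; lia.
rewrite -{1}(add0n i) big_addn addKn big_mkord.
transitivity (y j ^+ (M.-1 - i) * \sum_(a < m.+1) (u a)%:P * (q%:P * 'X) ^+ a * y j ^+ (m - a)).
  rewrite mulr_sumr; apply: eq_bigr => a _; rewrite leq_addl addnK /toep_low.
  have -> : (K.-1 - (a + i) = (M.-1 - i) + (m - a))%N by have := ltn_ord a; rewrite /K; lia.
  by rewrite exprD (exprMn a q%:P 'X) polyCM polyC_exp; ring.
rewrite qbinomial (bigD1 j) //= toep_poleE mul0r mulr0.
by [].
Qed.

Lemma det_Up : \det Up = 1.
Proof.
rewrite -det_tr det_trig => [|]; last first.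
  by apply/is_trig_mxP => i j lt_ij; rewrite !mxE leqNgt lt_ij.
apply: big1 => i _; rewrite !mxE leqnn subnn /toep_up big_ord1 /toep_c /=.
by rewrite /u /qbin_coef big_ord0 !mulr1.
Qed.

Lemma det_usub_Low : \det (usubmx Low) = 1.
Proof.
rewrite det_trig; last first.
  by apply/is_trig_mxP => i j lt_ij; rewrite !mxE /= leqNgt lt_ij.
apply: big1 => i _; rewrite !mxE /= leqnn subnn /toep_low.
by rewrite /u /qbin_coef big_ord0 !mulr1.
Qed.

Lemma toep_mxE : toep_mx q u M K = usubmx Up *m Low.
Proof.
by apply/matrixP=> i j; rewrite !mxE; apply: eq_bigr => k _; rewrite !mxE.
Qed.

Let V : 'M[{poly R}]_(M + m, m) := invmx Up *m col_mx 0 1%:M.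

(** A complementary minor argument on the square matrix [row_mx Low V]: multiplied by the unimodular
    [Up] it is block triangular with determinant that of [toep_mx]; multiplied by [P] it is block
    triangular with determinant that of [Ev *m V], as [Ev] kills [Low]. *)
Lemma det_Ev_V : \det (Ev *m V) = \det (rsubmx Ev) * \det (toep_mx q u M K).
Proof.
have unitUp : Up \in unitmx by rewrite unitmxE det_Up unitr1.
have detX : \det (row_mx Low V) = \det (toep_mx q u M K).
  rewrite -[LHS]mul1r -det_Up -det_mulmx mul_mx_row /V mulKVmx //.
  by rewrite -[Up *m Low]vsubmxK -block_mxEh det_lblock det1 mulr1 -mul_usub_mx toep_mxE.
pose P := block_mx (1%:M : 'M[{poly R}]_M) 0 (lsubmx Ev) (rsubmx Ev).
have : \det (P *m row_mx Low V) = \det (Ev *m V).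
  have -> : P *m row_mx Low V = block_mx (usubmx Low) (usubmx V) 0 (Ev *m V).
    have top k (Z : 'M[{poly R}]_(M + m, k)) : row_mx 1%:M 0 *m Z = usubmx Z.
      by rewrite -[Z in LHS]vsubmxK mul_row_col mul1mx mul0mx addr0.
    by rewrite /P !block_mxEv hsubmxK mul_col_mx !mul_mx_row Ev_Low !top.
  by rewrite det_ublock det_usub_Low mul1r.
by rewrite det_mulmx det_lblock det1 mul1r detX => <-.
Qed.

Lemma Ev_Up_mod j l : eqmodX K ((Ev *m Up) j l) (up_val j * Ev j l).
Proof.
have lt_lK : (l < K)%N := ltn_ord l.
have -> : (Ev *m Up) j l =
    \sum_(d < K) if (d < l.+1)%N then toep_up u d * y j ^+ (K.-1 - l + d) else 0.
  transitivity (\sum_(k < K | (k < l.+1)%N) y j ^+ (K.-1 - k) * toep_up u (l - k)).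
    rewrite mxE [RHS]big_mkcond; apply: eq_bigr => k _; rewrite !mxE ltnS.
    by case: ifP; rewrite ?mulr0.
  rewrite -[RHS]big_mkcond.
  rewrite -(big_ord_widen K (fun k => y j ^+ (K.-1 - k) * toep_up u (l - k))) //.
  rewrite -(big_ord_widen K (fun d => toep_up u d * y j ^+ (K.-1 - l + d))) //.
  rewrite (reindex_inj rev_ord_inj); apply: eq_bigr => k _ /=.
  have lt_kl := ltn_ord k.
  rewrite subSS subKn // mulrC; congr (_ * _ ^+ _); lia.
rewrite /up_val mulr_suml; apply: eqmodX_sum => d _; rewrite mxE -mulrA -exprD.
(* The terms with [d > l] are absent from the matrix product, but they carry at least [y^K]. *)
case: ltnP => [_|lt_ld]; first by rewrite addnC.
by apply/eqmodX_sym; rewrite /y exprMn mulrA; apply: eqmodX_mulXn; lia.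
Qed.

Lemma toep_pole_inj : injective toep_pole.
Proof.
move=> i j /oppr_inj/(mulfI (q_neq0))/invr_inj eq_q.
have lt_q a b : (a < b)%N -> q ^+ (2 * a.+1) < q ^+ (2 * b.+1).
  by move=> lt_ab; rewrite ltr_eXn2l // ltn_mul2l ltnS.
by case: (ltngtP i j) => // /lt_q; rewrite eq_q ltxx.
Qed.

Lemma det_W0_neq0 : \det W0 != 0.
Proof.
pose s := perm (@rev_ord_inj m).
have : \det (col_perm s W0) != 0.
  have -> : col_perm s W0 = (Vandermonde m (\row_(j < m) toep_pole j))^T.
    apply/matrixP=> j i; rewrite !mxE permE /=; congr (_ ^+ _).
    by have := ltn_ord i; lia.
  rewrite det_tr det_Vandermonde; apply/prodf_neq0 => i _; apply/prodf_neq0 => j lt_ij.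
  rewrite !mxE subr_eq0; apply: contraTneq lt_ij => /toep_pole_inj ->.
  by rewrite ltnn.
by rewrite col_permE det_mulmx mulf_eq0 negb_or => /andP[].
Qed.

(** Scaling the rows of [Ev *m V] by the approximate eigenvalues gives [Ev *m Up *m V], the right
    block of [Ev], modulo [X^K]. Then take determinants and cancel that of this block. *)
Lemma up_val_det : eqmodX M.+1 (\prod_(j < m) up_val j * \det (toep_mx q u M K)) 1.
Proof.
pose G := diag_mx (\row_j up_val j) *m (Ev *m V).
have unitUp : Up \in unitmx by rewrite unitmxE det_Up unitr1.
have WE j i : (rsubmx Ev) j i = (W0 j i)%:P * 'X^(m.-1 - i).
  rewrite !mxE /= /y exprMn polyC_exp /K.
  by have -> : ((M + m).-1 - (M + i) = m.-1 - i)%N by lia.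
have G_mod j i : eqmodX K (G j i) ((rsubmx Ev) j i).
  have -> : rsubmx Ev = Ev *m Up *m V.
    by rewrite /V -mulmxA mulKVmx // -[Ev in RHS]hsubmxK mul_row_col mulmx0 add0r mulmx1.
  have -> : G j i = up_val j * \sum_l Ev j l * V l i.
    by rewrite /G mul_diag_mx [LHS]mxE [(\row__ _) _ _]mxE [(Ev *m V) _ _]mxE.
  rewrite [X in eqmodX _ _ X]mxE mulr_sumr.
  apply: eqmodX_sum => l _; rewrite mulrA; apply: eqmodXM => //.
  by apply/eqmodX_sym/Ev_Up_mod.
(* Column [i] is divisible by [X^(m-1-i)]. Dividing costs at most [m - 1] of the [M + m] known
   orders, which leaves [M + 1], and turns the right block of [Ev] into the constant invertible
   [W0]. *)
pose G' : 'M[{poly R}]_m := \matrix_(j, i) drop_poly (m.-1 - i) (G j i).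
pose X := \row_(i < m) ('X^(m.-1 - i) : {poly R}).
have G'_mod j i : eqmodX M.+1 (G' j i) (map_mx polyC W0 j i).
  move=> k lt_kM; rewrite mxE coef_drop_poly G_mod ?WE ?[in RHS]mxE; last first.
    by have := ltn_ord i; rewrite /K; lia.
  by rewrite coefMXn ltnNge leq_addl addnK !mxE.
have GE : G = G' *m diag_mx X.
  apply/matrixP=> j i; rewrite mul_mx_diag [RHS]mxE [G' j i]mxE [X _ _]mxE.
  rewrite -[LHS](poly_take_drop (m.-1 - i)) -[RHS]add0r; congr (_ + _).
  apply/polyP => k; rewrite coef_take_poly coef0; case: ltnP => // lt_k.
  by rewrite G_mod ?WE ?coefMXn ?lt_k //; have := ltn_ord i; rewrite /K; lia.
have WE' : rsubmx Ev = map_mx polyC W0 *m diag_mx X.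
  by apply/matrixP=> j i; rewrite mul_mx_diag WE [RHS]mxE [map_mx _ _ _ _]mxE [X _ _]mxE.
have detG : \prod_(j < m) up_val j * \det (toep_mx q u M K) * (\det W0)%:P = \det G'.
  have nzX : \det (diag_mx X) != 0.
    by rewrite det_diag; apply/prodf_neq0 => i _; rewrite mxE -size_poly_eq0 size_polyXn.
  apply: (mulIf nzX); rewrite -det_mulmx -GE /G [RHS]det_mulmx [X in _ = X * _]det_diag.
  rewrite det_Ev_V WE' det_mulmx.
  rewrite det_map_mx /=.
  have -> : \prod_(i < m) (\row_j up_val j) 0 i = \prod_(j < m) up_val j.
    by apply: eq_bigr => i _; rewrite mxE.
  by ring.
have : eqmodX M.+1 (\prod_(j < m) up_val j * \det (toep_mx q u M K) * (\det W0)%:P)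
                   (\det W0)%:P.
  by rewrite detG -[X in eqmodX _ _ X]det_map_mx; apply: eqmodX_det.
move=> /eqmodXM /(_ (@eqmodX_refl _ _ ((\det W0)^-1)%:P)).
by rewrite -[X in eqmodX _ X]mulrA -!polyCM divff ?det_W0_neq0 // polyC1 mulr1.
Qed.

Lemma up_val_mod (j : 'I_m) : (0 < M)%N -> eqmodX M.+1 ((1 - y j) * up_val j)
  ((1 + y j) * \prod_(i < m) (1 + (q ^- (2 * i.+1))%:P * ('X * y j))).
Proof.
move=> M_gt0; have m_gt0 : (0 < m)%N by have := ltn_ord j; lia.
have defK : K = K.-1.+1 by rewrite prednK // /K; lia.
rewrite /up_val defK toep_up_eval -qbinomial.
have -> : \sum_(d < K.-1.+1) (u d)%:P * ('X * y j) ^+ d =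
    \sum_(a < m.+1) (u a)%:P * ('X * y j) ^+ a * 1 ^+ (m - a).
  under [RHS]eq_bigr do rewrite expr1n mulr1.
  (* The full [q]-binomial sum must fit below the cut: [m < K], which is [M > 0]. *)
  rewrite [RHS](big_ord_widen K.-1.+1 (fun a => (u a)%:P * ('X * y j) ^+ a)); last first.
    by rewrite /K; lia.
  rewrite [RHS]big_mkcond; apply: eq_bigr => a _; case: ltnP => // lt_ma.
  by rewrite /u qbin_coef_gt // mul0r.
rewrite -[X in eqmodX _ _ X]addr0; apply: eqmodXD => //.
rewrite -defK /y exprMn mulrA -mulNr; apply: eqmodX_mulXn.
by rewrite /K; lia.
Qed.

Definition toep_den : {poly R} := \prod_(j < m) ((1 + (toep_pole j)%:P * 'X) *
  \prod_(i < m) (1 + (q ^- (2 * i.+1) * toep_pole j)%:P * 'X^2)).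

Definition toep_num : {poly R} := \prod_(j < m) (1 - (toep_pole j)%:P * 'X).

Lemma det_toep_mx_mod : (0 < M)%N ->
  eqmodX M.+1 (toep_den * \det (toep_mx q u M K)) toep_num.
Proof.
move=> M_gt0; have := up_val_det => /(eqmodXM (@eqmodX_refl _ _ toep_num)).
rewrite mulr1; apply: eqmodX_trans; rewrite mulrA; apply: eqmodXM => //.
apply/eqmodX_sym; rewrite /toep_num -big_split; apply: eqmodX_prod => j _ /=.
apply: eqmodX_trans (up_val_mod _ M_gt0) _; apply: eqmodXM => //.
apply: eqmodX_prod => i _; rewrite polyCM /y expr2.
by have -> : (q ^- (2 * i.+1))%:P * ('X * ((toep_pole j)%:P * 'X)) =
  (q ^- (2 * i.+1))%:P * (toep_pole j)%:P * ('X * 'X) by ring.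
Qed.

End Evaluation.

End FiniteToeplitz.

(** * Power series as truncated fractions of polynomials *)

Section SeriesAsFractions.
Variable (R : realType).
Implicit Types (f g : pser R) (N D : {poly R}).

(* [f] is the expansion of [N / D] up to degree [n]. *)
Definition ps_frac n f N D := eqmodX n.+1 ((\poly_(i < n.+1) f i) * D) N.

Lemma ps_frac_mul n f g N D N' D' :
  ps_frac n f N D -> ps_frac n g N' D' -> ps_frac n (ps_mul f g) (N * N') (D * D').
Proof.
move=> fND gND; have := eqmodXM fND gND; apply: eqmodX_trans.
rewrite mulrACA; apply: eqmodXM => // i lt_in; rewrite coefM coef_poly lt_in /ps_mul.
by apply: eq_bigr => j _; rewrite !coef_poly !ifT //; have := ltn_ord j; lia.
Qed.

Lemma ps_frac_one n : ps_frac n (@ps_one R) 1 1.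
Proof. by move=> i lt_in; rewrite mulr1 coef_poly lt_in coef1. Qed.

Lemma ps_frac_big n (I : Type) (r : seq I) (P : pred I) (F : I -> pser R) (N D : I -> {poly R}) :
    (forall i, P i -> ps_frac n (F i) (N i) (D i)) ->
  ps_frac n (\big[@ps_mul R/@ps_one R]_(i <- r | P i) F i)
    (\prod_(i <- r | P i) N i) (\prod_(i <- r | P i) D i).
Proof.
move=> FND; elim/big_rec3: _ => [|i f N' D' Pi ?]; first exact: ps_frac_one.
by apply: ps_frac_mul => //; apply: FND.
Qed.

Lemma ps_frac_lin n (a : R) : ps_frac n (ps_lin a) (1 + a%:P * 'X) 1.
Proof.
move=> i lt_in; rewrite mulr1 coef_poly lt_in /ps_lin coefD coefCM coef1 coefX.
by case: i {lt_in} => [|[|i]] /=; rewrite ?mulr0 ?mulr1 ?addr0 ?add0r.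
Qed.

Lemma ps_frac_geom n (a : R) : ps_frac n (ps_geom a) 1 (1 - a%:P * 'X).
Proof.
move=> i lt_in; rewrite mulrBr mulr1 mulrCA coefB coefCM coefMX !coef_poly lt_in coef1.
rewrite /ps_geom; case: i lt_in => [|i] lt_in /=; first by rewrite mulr0 subr0.
by rewrite (ltnW lt_in) -exprS subrr.
Qed.

Lemma ps_frac_geom2 n (b : R) : ps_frac n (ps_geom2 b) 1 (1 - b%:P * 'X^2).
Proof.
move=> i lt_in; rewrite mulrBr mulr1 mulrCA coefB coefCM coefMXn !coef_poly lt_in coef1.
rewrite /ps_geom2; case: i lt_in => [|[|i]] lt_in /=; rewrite ?mulr0 ?subr0 //.
rewrite !subSS subn0 (ltnW (ltnW lt_in)) negbK.
by case: odd; rewrite ?mulr0 ?subr0 // -exprS subrr.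
Qed.

(** A denominator with constant term 1 can be cancelled degree by degree. *)
Lemma ps_frac_unique n f N D (p : {poly R}) : D`_0 = 1 ->
  ps_frac n f N D -> eqmodX n.+1 (D * p) N -> forall i, (i <= n)%N -> f i = p`_i.
Proof.
move=> D0 fND pND; pose d := (\poly_(i < n.+1) f i) - p.
have dD0 i : (i < n.+1)%N -> (d * D)`_i = 0.
  by move=> lt_in; rewrite mulrBl coefB fND // mulrC pND // subrr.
have d0 i : (i < n.+1)%N -> d`_i = 0.
  elim/ltn_ind: i => i IH lt_in; have := dD0 i lt_in.
  rewrite coefM big_ord_recr /= subnn D0 mulr1 big1 ?add0r // => j _.
  by rewrite IH ?mul0r //; have := ltn_ord j; lia.
move=> i le_in; have := d0 i le_in; rewrite coefB coef_poly ltnS le_in => /eqP.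
by rewrite subr_eq0 => /eqP.
Qed.

End SeriesAsFractions.

(** * The coefficientwise order on power series *)

Section SeriesOrder.
Variable (R : realType).
Implicit Types (f g : pser R).

Definition ps_le f g := forall n, f n <= g n.
Definition ps_nneg f := forall n, 0 <= f n.

Lemma ps_le_refl f : ps_le f f. Proof. by move=> n. Qed.

Lemma ps_mul_nneg f g : ps_nneg f -> ps_nneg g -> ps_nneg (ps_mul f g).
Proof. by move=> f0 g0 n; apply: sumr_ge0 => i _; apply: mulr_ge0. Qed.

Lemma ps_mul_le f f' g g' : ps_nneg f -> ps_nneg g ->
  ps_le f f' -> ps_le g g' -> ps_le (ps_mul f g) (ps_mul f' g').
Proof. by move=> f0 g0 ff' gg' n; apply: ler_sum => i _; apply: ler_pM. Qed.

Lemma ps_one_nneg : ps_nneg (@ps_one R).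
Proof. by move=> n; rewrite ler0n. Qed.

Lemma ps_one_le f : ps_nneg f -> f 0%N = 1 -> ps_le (@ps_one R) f.
Proof. by move=> f0 f1 [|n]; rewrite /ps_one ?f1. Qed.

Lemma ps_mul0 f g : (ps_mul f g) 0%N = f 0%N * g 0%N.
Proof. by rewrite /ps_mul big_ord1. Qed.

Section Big.
Variables (I : eqType) (P : pred I).
Implicit Types (r : seq I) (F : I -> pser R).

Lemma big_ps_nneg r F g : ps_nneg g -> (forall i, P i -> ps_nneg (F i)) ->
  ps_nneg (\big[@ps_mul R/g]_(i <- r | P i) F i).
Proof.
by move=> g0 F0; elim/big_ind: _ => // f1 f2; apply: ps_mul_nneg.
Qed.

Lemma big_ps_0 r F : (forall i, P i -> F i 0%N = 1) ->
  (\big[@ps_mul R/@ps_one R]_(i <- r | P i) F i) 0%N = 1.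
Proof.
move=> F1; elim/big_rec: _ => [|i f Pi f1]; first by rewrite /ps_one eqxx.
by rewrite ps_mul0 F1 // f1 mulr1.
Qed.

Lemma big_ps_le r F F' g g' :
    ps_nneg g -> ps_le g g' -> (forall i, P i -> ps_nneg (F i)) ->
    {in r, forall i, P i -> ps_le (F i) (F' i)} ->
  ps_le (\big[@ps_mul R/g]_(i <- r | P i) F i) (\big[@ps_mul R/g']_(i <- r | P i) F' i).
Proof.
move=> g0 gg' F0; elim: r => [|i r IH] FF'; first by rewrite !big_nil.
rewrite !big_cons; have leIH : ps_le (\big[@ps_mul R/g]_(i <- r | P i) F i)
    (\big[@ps_mul R/g']_(i <- r | P i) F' i).
  by apply: IH => j jr; apply: FF'; rewrite inE jr orbT.
case: ifP => // Pi; apply: ps_mul_le => //; [exact: F0 | exact: big_ps_nneg |].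
by apply: FF'; rewrite ?inE ?eqxx.
Qed.

End Big.

Lemma big_nat_ps_le (P : pred nat) (F F' : nat -> pser R) m n n' :
    (n <= n')%N -> (forall i, P i -> ps_nneg (F i)) ->
    (forall i, P i -> ps_nneg (F' i) /\ F' i 0%N = 1) ->
    (forall i, (m <= i < n)%N -> P i -> ps_le (F i) (F' i)) ->
  ps_le (\big[@ps_mul R/@ps_one R]_(m <= i < n | P i) F i)
        (\big[@ps_mul R/@ps_one R]_(m <= i < n' | P i) F' i).
Proof.
move=> le_nn' F0 F'1 FF'.
have one_le r : ps_le (@ps_one R) (\big[@ps_mul R/@ps_one R]_(i <- r | P i) F' i).
  apply: ps_one_le; last by apply: big_ps_0 => i /F'1[].
  by apply: big_ps_nneg => [|i /F'1[]//]; exact: ps_one_nneg.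
case: (leqP m n) => [le_mn|lt_nm]; last first.
  by rewrite [X in ps_le X]big_geq ?(ltnW lt_nm).
have -> : index_iota m n' = index_iota m n ++ index_iota n n'.
  by rewrite /index_iota -{2}(subnKC le_mn) -iotaD; congr iota; lia.
(* The extra factors become the start value of the fold, which dominates [ps_one]; [ps_mul] is never
   reassociated. *)
rewrite big_cat_nested; apply: big_ps_le; [exact: ps_one_nneg | exact: one_le | exact: F0 |].
by move=> i; rewrite mem_index_iota => /FF'.
Qed.

End SeriesOrder.

(** Two indices with odd sum are one even and one odd number, in either order of size. Going from
    [m] to [m + 1] adds the pairs with larger index [2m + 1] ([col]) and [2m + 2] ([row]). *)
Lemma prod_odd_pairs (T : comNzRingType) (g : nat -> T) m :
  \prod_(1 <= i < (2 * m).+1) \prod_(i.+1 <= j < (2 * m).+1 | odd (i + j)) g (i + j)%N =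
  \prod_(j < m) \prod_(i < m) g (2 * i.+1 + (2 * j.+1 - 1))%N.
Proof.
have tri K : \prod_(1 <= i < K.+1) \prod_(i.+1 <= j < K.+1 | odd (i + j)) g (i + j)%N =
    \prod_(1 <= j < K.+1) \prod_(1 <= i < j | odd (i + j)) g (i + j)%N.
  elim: K => [|K IH]; first by rewrite !big_geq.
  rewrite big_nat_recr //= [RHS]big_nat_recr //= -IH.
  rewrite [X in _ * X = _]big_geq // mulr1 [X in _ = _ * X]big_mkcond /= -big_split /=.
  rewrite !big_nat; apply: eq_bigr => i /andP[_ lt_iK].
  by rewrite [in LHS]big_mkcond big_nat_recr //= -big_mkcond.
have col n : \prod_(1 <= i < (2 * n).+1 | odd (i + (2 * n).+1)) g (i + (2 * n).+1)%N =
    \prod_(i < n) g (2 * i.+1 + (2 * n.+1 - 1))%N.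
  have aux c : odd c -> \prod_(1 <= i < (2 * n).+1 | odd (i + c)) g (i + c)%N =
      \prod_(i < n) g (2 * i.+1 + c)%N.
    move=> odd_c; elim: (n) => [|k IH]; first by rewrite big_geq // big_ord0.
    rewrite big_ord_recr /= -IH; have -> : (2 * k.+1 = (2 * k).+2)%N by lia.
    rewrite !(big_mkcond (fun i => odd (i + c))) big_nat_recr // big_nat_recr //.
    have o1 : odd ((2 * k).+1 + c) = false by rewrite oddD /= oddM odd_c.
    have o2 : odd ((2 * k).+2 + c) by rewrite oddD /= oddM odd_c.
    by rewrite o1 o2 /= mulr1.
  by rewrite aux //; [apply: eq_bigr => i _; congr g; lia | rewrite /= oddM].
have row n : \prod_(1 <= i < (2 * n).+2 | odd (i + (2 * n).+2)) g (i + (2 * n).+2)%N =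
    \prod_(j < n.+1) g (2 * n.+1 + (2 * j.+1 - 1))%N.
  have aux c k : ~~ odd c -> \prod_(1 <= i < (2 * k).+2 | odd (i + c)) g (i + c)%N =
      \prod_(j < k.+1) g (c + (2 * j.+1 - 1))%N.
    move=> even_c; elim: k => [|k IH].
      by rewrite big_ord1 big_mkcond big_nat1 add1n /= even_c; congr g; lia.
    rewrite big_ord_recr /= -IH; have -> : (2 * k.+1 = (2 * k).+2)%N by lia.
    rewrite !(big_mkcond (fun i => odd (i + c))) big_nat_recr // big_nat_recr //.
    have o1 : odd ((2 * k).+2 + c) = false by rewrite oddD /= oddM (negPf even_c).
    have o2 : odd ((2 * k).+3 + c) by rewrite oddD /= oddM (negPf even_c).
    by rewrite o1 o2 /= mulr1; congr (_ * g _); lia.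
  by rewrite aux; [apply: eq_bigr => i _; congr g; lia | rewrite /= oddM].
rewrite tri; elim: m => [|m IH]; first by rewrite big_geq // big_ord0.
have -> : (2 * m.+1 = (2 * m).+2)%N by lia.
rewrite big_nat_recr // big_nat_recr //= {}IH col row.
rewrite [RHS]big_ord_recr /=.
under [X in _ = X * _]eq_bigr do rewrite big_ord_recr /=.
rewrite big_split /= -!mulrA; congr (_ * _).
rewrite [X in _ = _ * X]big_ord_recr [X in _ * X = _]big_ord_recr /=.
by ring.
Qed.

(** * Monotonicity of the partial products *)

Section PartialProducts.
Variables (R : realType) (q : R).
Hypothesis q_gt1 : 1 < q.
Let q_gt0 : 0 < q. Proof. exact: lt_trans ltr01 q_gt1. Qed.

Definition prod1_factor i := ps_mul (ps_lin (q ^- (2 * i - 1))) (ps_geom (q ^- (2 * i - 1))).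

Definition prod1 M : pser R := \big[@ps_mul R/@ps_one R]_(1 <= i < M.+1) prod1_factor i.

Definition prod2_inner M i : pser R :=
  \big[@ps_mul R/@ps_one R]_(i.+1 <= j < M.+1 | odd (i + j)) ps_geom2 (q ^- (i + j)).

Definition prod2 M : pser R := \big[@ps_mul R/@ps_one R]_(1 <= i < M.+1) prod2_inner M i.

Lemma partial_prodE M : partial_prod q M = ps_mul (prod1 M) (prod2 M).
Proof. by []. Qed.

Lemma qVn_ge0 n : 0 <= q ^- n.
Proof. by rewrite invr_ge0 exprn_ge0 // ltW. Qed.

Lemma prod1_factor_nneg i : ps_nneg (prod1_factor i) /\ prod1_factor i 0%N = 1.
Proof.
split; last by rewrite /prod1_factor ps_mul0 /ps_lin /ps_geom mul1r.
apply: ps_mul_nneg => n; last by rewrite exprn_ge0 // qVn_ge0.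
by rewrite /ps_lin; case: ifP => // _; case: ifP => // _; exact: qVn_ge0.
Qed.

Lemma geom2_nneg k : ps_nneg (ps_geom2 (q ^- k)) /\ ps_geom2 (q ^- k) 0%N = 1.
Proof.
split=> // n; rewrite /ps_geom2; case: ifP => // _.
by rewrite exprn_ge0 // qVn_ge0.
Qed.

Lemma prod2_inner_nneg M i : ps_nneg (prod2_inner M i) /\ prod2_inner M i 0%N = 1.
Proof.
split; last by apply: big_ps_0 => j _; have [] := geom2_nneg (i + j).
by apply: big_ps_nneg => [|j _]; [exact: ps_one_nneg | have [] := geom2_nneg (i + j)].
Qed.

Lemma prod1_nneg M : ps_nneg (prod1 M).
Proof.
by apply: big_ps_nneg => [|i _]; [exact: ps_one_nneg | have [] := prod1_factor_nneg i].
Qed.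

Lemma prod2_nneg M : ps_nneg (prod2 M).
Proof.
by apply: big_ps_nneg => [|i _]; [exact: ps_one_nneg | have [] := prod2_inner_nneg M i].
Qed.

Lemma prod1_le M M' : (M <= M')%N -> ps_le (prod1 M) (prod1 M').
Proof.
move=> le_MM'; apply: big_nat_ps_le => // i; last by move=> _ _; exact: ps_le_refl.
  by move=> _; have [] := prod1_factor_nneg i.
by move=> _; exact: prod1_factor_nneg.
Qed.

Lemma prod2_le M M' : (M <= M')%N -> ps_le (prod2 M) (prod2 M').
Proof.
move=> le_MM'; apply: big_nat_ps_le => // i.
- by move=> _; have [] := prod2_inner_nneg M i.
- by move=> _; exact: prod2_inner_nneg.
move=> _ _; apply: big_nat_ps_le => // j; last by move=> _ _; exact: ps_le_refl.
  by move=> _; have [] := geom2_nneg (i + j).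
by move=> _; exact: geom2_nneg.
Qed.

(* The square analogue of [partial_prod]: all odd numbers [2 i - 1] and all even
   numbers [2 i] with [i <= m] occur, in both factors. *)
Definition square_prod m : pser R := ps_mul (prod1 m) (prod2 (2 * m)).

(** All factors have non-negative coefficients and constant term 1, so longer products are larger,
    and [2 * M./2 <= M <= 2 * M]. *)
Lemma partial_prod_bounds M :
  ps_le (square_prod (M./2)) (partial_prod q M) /\ ps_le (partial_prod q M) (square_prod M).
Proof.
rewrite partial_prodE; split; apply: ps_mul_le => //;
  try exact: prod1_nneg; try exact: prod2_nneg; try exact: ps_le_refl.
- by apply: prod1_le; lia.
- by apply: prod2_le; lia.
- by apply: prod2_le; lia.
Qed.

End PartialProducts.

(** * Coefficientwise limits of polynomials and determinants *)

Section CoefficientwiseLimits.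
Variables (R : realType) (q : R).

(** For [k >= M + n] and [j < M] we have [k - j > n], so [toep_low] is divisible by [X^(n+1)]. *)
Lemma det_toep_mx_stable (u : nat -> R) M n L : (M + n <= L)%N ->
  eqmodX n.+1 (\det (toep_mx q u M L)) (\det (toep_mx q u M (M + n))).
Proof.
move=> le_L; apply: eqmodX_det => i j; rewrite !mxE.
pose F k := (if (i <= k)%N then toep_up u (k - i) else 0)
    * (if (j <= k)%N then toep_low q u (k - j) else 0).
rewrite -!(big_mkord xpredT F) (@big_cat_nat _ _ _ (M + n)%N) //=.
rewrite -[X in eqmodX _ _ X]addr0; apply: eqmodXD => //.
rewrite big_nat -[X in eqmodX _ _ X](@big1_eq _ _ +%R _ (index_iota (M + n) L)
  (fun k => (M + n <= k < L)%N)).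
apply: eqmodX_sum => k /andP[le_k _]; rewrite /F; have lt_j := ltn_ord j.
case: (leqP j k) => le_jk; last by rewrite mulr0.
by rewrite /toep_low mulrA; apply: eqmodX_mulXn; lia.
Qed.

Definition poly_cvg (P : nat -> {poly R}) (p : {poly R}) : Prop :=
  forall i, (P m)`_i @[m --> \oo] --> p`_i.

Lemma poly_cvg_cst p : poly_cvg (fun=> p) p.
Proof. by move=> i; apply: cvg_cst. Qed.

Lemma poly_cvgD P Q p r : poly_cvg P p -> poly_cvg Q r ->
  poly_cvg (fun m => P m + Q m) (p + r).
Proof. by move=> Pp Qr i; rewrite coefD; under eq_fun do rewrite coefD; apply: cvgD. Qed.

Lemma poly_cvg_sum (I : Type) (r : seq I) (P : pred I) (F : I -> nat -> {poly R}) G :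
    (forall i, P i -> poly_cvg (F i) (G i)) ->
  poly_cvg (fun m => \sum_(i <- r | P i) F i m) (\sum_(i <- r | P i) G i).
Proof.
move=> FG; elim: r => [|i r IH].
  by under eq_fun do rewrite big_nil; rewrite big_nil; exact: poly_cvg_cst.
under eq_fun do rewrite big_cons; rewrite big_cons.
by case: ifP => // Pi; apply: poly_cvgD => //; exact: FG.
Qed.

Lemma cvg_sum_seq (I : Type) (r : seq I) (F : I -> nat -> R) (G : I -> R) :
    (forall i, F i m @[m --> \oo] --> G i) ->
  \sum_(i <- r) F i m @[m --> \oo] --> \sum_(i <- r) G i.
Proof.
move=> FG; elim: r => [|i r IH].
  by under eq_fun do rewrite big_nil; rewrite big_nil; exact: cvg_cst.
by under eq_fun do rewrite big_cons; rewrite big_cons; apply: cvgD.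
Qed.

Lemma poly_cvgM P Q p r : poly_cvg P p -> poly_cvg Q r ->
  poly_cvg (fun m => P m * Q m) (p * r).
Proof.
move=> Pp Qr i; rewrite coefM; under eq_fun do rewrite coefM.
by apply: cvg_sum_seq => j; apply: cvgM.
Qed.

Lemma poly_cvg_prod (I : Type) (r : seq I) (P : pred I) (F : I -> nat -> {poly R}) G :
    (forall i, P i -> poly_cvg (F i) (G i)) ->
  poly_cvg (fun m => \prod_(i <- r | P i) F i m) (\prod_(i <- r | P i) G i).
Proof.
move=> FG; elim: r => [|i r IH].
  by under eq_fun do rewrite big_nil; rewrite big_nil; exact: poly_cvg_cst.
under eq_fun do rewrite big_cons; rewrite big_cons.
by case: ifP => // Pi; apply: poly_cvgM => //; exact: FG.
Qed.

Lemma poly_cvg_det k (A : nat -> 'M[{poly R}]_k) (B : 'M[{poly R}]_k) :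
  (forall i j, poly_cvg (fun m => A m i j) (B i j)) ->
  poly_cvg (fun m => \det (A m)) (\det B).
Proof.
move=> AB; apply: poly_cvg_sum => s _; apply: poly_cvgM; first exact: poly_cvg_cst.
by apply: poly_cvg_prod => i _; exact: AB.
Qed.

Lemma poly_cvgC (f : nat -> R) (l : R) :
  f m @[m --> \oo] --> l -> poly_cvg (fun m => (f m)%:P) l%:P.
Proof.
move=> fl i; rewrite coefC; under eq_fun do rewrite coefC.
by case: eqP => // _; exact: cvg_cst.
Qed.

End CoefficientwiseLimits.

(** * The limit of the products as a determinant *)

Section SquareProduct.
Variables (R : realType) (q : R).
Hypothesis q_gt1 : 1 < q.

Lemma toep_pole_odd j : toep_pole q j = - q ^- (2 * j.+1 - 1).
Proof.
have q0 := q_neq0 q_gt1; rewrite /toep_pole.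
have -> : q ^+ (2 * j.+1) = q * q ^+ (2 * j.+1 - 1) by rewrite -exprS; congr (_ ^+ _); lia.
by rewrite invfM mulrA divff ?mul1r.
Qed.

Lemma square_prod_frac n m : ps_frac n (square_prod q m) (toep_num q m) (toep_den q m).
Proof.
have -> : toep_num q m =
    \prod_(1 <= i < m.+1) ((1 + (q ^- (2 * i - 1))%:P * 'X) * 1) *
    \prod_(1 <= i < (2 * m).+1) \prod_(i.+1 <= j < (2 * m).+1 | odd (i + j)) 1.
  rewrite [X in _ = _ * X]big1 ?mulr1; last by move=> i _; rewrite big1.
  rewrite big_add1 big_mkord; apply: eq_bigr => i _.
  by rewrite toep_pole_odd polyCN mulNr opprK mulr1.
have -> : toep_den q m =
    \prod_(1 <= i < m.+1) (1 * (1 - (q ^- (2 * i - 1))%:P * 'X)) *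
    \prod_(1 <= i < (2 * m).+1) \prod_(i.+1 <= j < (2 * m).+1 | odd (i + j))
       (1 - (q ^- (i + j))%:P * 'X^2).
  rewrite (prod_odd_pairs (fun k => 1 - (q ^- k)%:P * 'X^2)) big_add1 big_mkord -big_split.
  apply: eq_bigr => j _; rewrite toep_pole_odd polyCN mulNr mul1r; congr (_ * _).
  by apply: eq_bigr => i _; rewrite mulrN polyCN mulNr exprD invfM.
apply: ps_frac_mul; apply: ps_frac_big => i _.
  by apply: ps_frac_mul; [exact: ps_frac_lin | exact: ps_frac_geom].
by apply: ps_frac_big => j _; exact: ps_frac_geom2.
Qed.

Lemma toep_den0 m : (toep_den q m)`_0 = 1.
Proof.
rewrite -horner_coef0 horner_prod big1 // => j _.
by rewrite hornerM horner_prod big1 => [|i _]; rewrite !hornerE ?expr0n /= ?mulr0 ?addr0.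
Qed.

Lemma square_prodE n m M : (0 < M)%N -> (n <= M)%N ->
  square_prod q m n = (\det (toep_mx q (qbin_coef q m) M (M + m)))`_n.
Proof.
move=> M_gt0 le_nM.
exact: (@ps_frac_unique _ M _ _ _ _ (toep_den0 m) (@square_prod_frac M m)
  (@det_toep_mx_mod _ _ q_gt1 M m M_gt0)).
Qed.

Definition qfact_inv a : R := \prod_(j < a) (q ^+ (2 * j.+1) - 1)^-1.

Lemma cvg_qbin_coef a : qbin_coef q m a @[m --> \oo] --> qfact_inv a.
Proof.
have qV0 j : q ^- (2 * (m - j)) @[m --> \oo] --> (0 : R).
  rewrite -(cvg_shiftn j); under eq_fun do rewrite addnK exprM -exprVn.
  apply: cvg_expr; rewrite ger0_norm ?invr_ge0 ?exprn_ge0 ?ltW //; last first.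
    exact: lt_trans ltr01 q_gt1.
  by rewrite invf_lt1 ?exprn_gt0 ?(lt_trans ltr01 q_gt1) // exprn_egt1.
rewrite /qfact_inv /qbin_coef; elim: a => [|a IH].
  by under eq_fun do rewrite big_ord0; rewrite big_ord0; exact: cvg_cst.
under eq_fun do rewrite big_ord_recr; rewrite big_ord_recr.
apply: cvgM => //; rewrite -[X in _ --> X]mul1r /=; apply: cvgM; last exact: cvg_cst.
by rewrite -[X in _ --> X]subr0; apply: cvgB => //; exact: cvg_cst.
Qed.

Lemma poly_cvg_toep_mx k L (i j : 'I_k) :
  poly_cvg (fun m => toep_mx q (qbin_coef q m) k L i j) (toep_mx q qfact_inv k L i j).
Proof.
rewrite mxE; under eq_fun do rewrite mxE.
apply: poly_cvg_sum => l _; apply: poly_cvgM; case: ifP => _; try exact: poly_cvg_cst.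
  apply: poly_cvg_sum => a _; apply: poly_cvgM; last exact: poly_cvg_cst.
  by apply: poly_cvgC; apply: cvgM; [exact: cvg_cst | exact: cvg_qbin_coef].
apply: poly_cvgM; last exact: poly_cvg_cst.
by apply: poly_cvgC; apply: cvgM; [exact: cvg_qbin_coef | exact: cvg_cst].
Qed.

(** In [square_prodE] the cut [M + m] moves with [m]; for [m >= n] stability replaces it by [M + n],
    and then only the matrix entries vary. *)
Lemma cvg_square_prod n M : (0 < M)%N -> (n <= M)%N ->
  square_prod q m n @[m --> \oo] --> (\det (toep_mx q qfact_inv M (M + n)))`_n.
Proof.
move=> M_gt0 le_nM.
have /(_ n) cvg_det := @poly_cvg_det _ _ _ _ (@poly_cvg_toep_mx M (M + n)).
apply: cvg_trans cvg_det; apply: near_eq_cvg; near=> m.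
rewrite (square_prodE _ M_gt0 le_nM); apply/esym; apply: det_toep_mx_stable => //.
by rewrite leq_add2l; near: m; exact: nbhs_infty_ge.
Unshelve. all: by end_near.
Qed.

Lemma cvg_half_nat : (m./2 @[m --> \oo] --> \oo)%classic.
Proof.
apply/cvgnyPge => A; near=> m; have : (A.*2 <= m)%N by near: m; exact: nbhs_infty_ge.
by move=> /half_leq; rewrite doubleK.
Unshelve. all: by end_near.
Qed.

Lemma cvg_partial_prod n M : (0 < M)%N -> (n <= M)%N ->
  partial_prod q m n @[m --> \oo] --> (\det (toep_mx q qfact_inv M (M + n)))`_n.
Proof.
move=> M_gt0 le_nM; have cvg_sq := cvg_square_prod M_gt0 le_nM.
apply: (@squeeze_cvgr _ _ _ _ (fun m => square_prod q m./2 n) (fun m => square_prod q m n)).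
- by near=> m; have [le1 le2] := partial_prod_bounds q_gt1 m; rewrite le1 le2.
- exact: cvg_comp cvg_half_nat cvg_sq.
- exact: cvg_sq.
Unshelve. all: by end_near.
Qed.

End SquareProduct.

(** * Rank of a symbol and bounds on its size *)

Section Rank.
Local Open Scope fset_scope.
Local Open Scope ring_scope.

Definition sym_sum (X : symbol) : nat := (\sum_(a <- X.1) a + \sum_(b <- X.2) b)%N.

Lemma sym_rankE (X : symbol) M n : symN X = (M + M)%N ->
  (sym_rank X = n%:Z) <-> sym_sum X = (n + M * M.-1)%N.
Proof.
move=> NX; rewrite /sym_rank -/(sym_sum X) NX.
have -> : (((M + M)%:Z - 1) ^+ 2 %/ 4)%Z = (M * M.-1)%:Z.
  have -> : ((M + M)%:Z - 1) ^+ 2 = (M * M.-1)%:Z * 4 + 1.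
    by case: M {NX} => //= k; rewrite -[k.+1]addn1 ?PoszD ?PoszM ?PoszD; ring.
  by rewrite divzMDl // addr0.
split=> [/eqP|->]; first by rewrite subr_eq -PoszD => /eqP[].
by rewrite PoszD addrK.
Qed.

Lemma sum_subsets_below L (A : {fset nat}) : A \in subsets_below L ->
  (#|` A| <= L)%N /\ (#|` A| * #|` A|.-1 <= 2 * \sum_(a <- A) a)%N.
Proof.
elim: L A => [|L IH] A; first by rewrite inE => /eqP ->; rewrite cardfs0.
rewrite /= mem_cat => /orP[/IH[leA sA]|/mapP[B inB ->]]; first by split=> //; apply: leqW.
have LB := subsets_below_notin inB; have [leB sB] := IH B inB.
rewrite cardfsU1 LB add1n /= big_fsetU1 //=; split=> //.
by case: #|` B| leB sB => [|k] /=; nia.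
Qed.

Lemma sum_fset_ge (A : {fset nat}) : (#|` A| * #|` A|.-1 <= 2 * \sum_(a <- A) a)%N.
Proof.
apply: (proj2 (@sum_subsets_below (\sum_(a <- A) a).+1 A _)).
by apply/mem_subsets_below => a aA; rewrite ltnS (big_fsetD1 a) //= leq_addr.
Qed.

Definition shift1 (A : {fset nat}) : {fset nat} := [fset a.+1 | a in A].
Definition shift0 (A : {fset nat}) : {fset nat} := 0%N |` shift1 A.
Definition unshift (A : {fset nat}) : {fset nat} := [fset a.-1 | a in A `\ 0%N].

Lemma zero_notin_shift1 A : 0%N \notin shift1 A.
Proof. by apply/imfsetP => -[]. Qed.

Lemma mem_shift1 A a : (a.+1 \in shift1 A) = (a \in A).
Proof. by rewrite mem_imfset //; exact: succn_inj. Qed.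

Lemma card_shift1 A : #|` shift1 A| = #|` A|.
Proof. by rewrite card_imfset //; exact: succn_inj. Qed.

Lemma big_shift1 (T : Type) (idx : T) (op : Monoid.com_law idx) A (F : nat -> T) :
  \big[op/idx]_(a <- shift1 A) F a = \big[op/idx]_(a <- A) F a.+1.
Proof. by rewrite big_imfset //= => a b _ _ []. Qed.

Lemma shift1_unshift A : 0%N \notin A -> shift1 (unshift A) = A.
Proof.
move=> A0; apply/fsetP => -[|a]; first by rewrite (negPf A0) (negPf (zero_notin_shift1 _)).
rewrite mem_shift1; apply/imfsetP/idP => /= [[b]|aA].
  by rewrite !inE => /andP[b0 bA] ->; rewrite prednK // lt0n.
by exists a.+1; rewrite ?inE.
Qed.

Lemma unshift_shift0 A : unshift (shift0 A) = A.
Proof.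
apply/fsetP => a; apply/imfsetP/idP => /= [[b]|aA].
  rewrite !inE => /andP[b0]; rewrite (negPf b0) /=.
  by case: b b0 => // b _; rewrite mem_shift1 => ? ->.
by exists a.+1; rewrite // !inE /= mem_shift1.
Qed.

Lemma shift0_unshift A : 0%N \in A -> shift0 (unshift A) = A.
Proof.
move=> A0; apply/fsetP => -[|a]; first by rewrite A0 !inE.
rewrite !inE /= mem_shift1; apply/imfsetP/idP => /= [[b]|aA].
  by rewrite !inE => /andP[b0 bA] ->; rewrite prednK // lt0n.
by exists a.+1; rewrite ?inE.
Qed.

Lemma card_shift0 A : #|` shift0 A| = #|` A|.+1.
Proof. by rewrite cardfsU1 zero_notin_shift1 card_shift1. Qed.

Lemma sum_shift1 A : (\sum_(a <- shift1 A) a = \sum_(a <- A) a + #|` A|)%N.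
Proof.
rewrite big_shift1 /=; under eq_bigr do rewrite -addn1.
by rewrite big_split /= sum1_size.
Qed.

Lemma sum_shift0 A : (\sum_(a <- shift0 A) a = \sum_(a <- A) a + #|` A|)%N.
Proof. by rewrite big_fsetU1 ?zero_notin_shift1 //= sum_shift1. Qed.

Lemma sum_fset_ge_pos (A : {fset nat}) : 0%N \notin A ->
  (#|` A| * #|` A|.+1 <= 2 * \sum_(a <- A) a)%N.
Proof.
move=> /shift1_unshift <-; have := sum_fset_ge (unshift A).
rewrite sum_shift1 card_shift1; set r := #|` _|; set s := (\sum_(a <- _) a)%N.
by case: r => //= r; nia.
Qed.

(** One of the two sets lacks 0, so with sizes [r], [k] in a suitable order twice the sum of entries
    is at least [r(r+1) + k(k-1)]. For [r = M + d], [k = M - d] this is [2M^2 + 2d(d+1) >= 2M^2],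
    whence [M <= n]. *)
Lemma ortho_symN_le (X : symbol) n : is_ortho_symbol X -> even_defect X ->
  sym_rank X = n%:Z -> (symN X <= n + n)%N.
Proof.
move=> oX eX; have [M defN] : exists M, symN X = (M + M)%N.
  by exists (symN X)./2; rewrite addnn even_halfK.
move/(sym_rankE _ defN); rewrite defN /sym_sum => sumX.
move: defN; rewrite /symN => defN.
have : ((#|` X.1| * #|` X.1|.+1 + #|` X.2| * #|` X.2|.-1 <= 2 * (n + M * M.-1)) \/
        (#|` X.1| * #|` X.1|.-1 + #|` X.2| * #|` X.2|.+1 <= 2 * (n + M * M.-1)))%N.
  rewrite -sumX mulnDr.
  have [zA|zA] := boolP (0%N \in X.1); last first.
    by left; rewrite leq_add ?sum_fset_ge_pos ?sum_fset_ge.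
  right; rewrite leq_add ?sum_fset_ge // sum_fset_ge_pos //.
  by apply/negP => zB; apply: oX; rewrite zA zB.
have pred_sqr k : (k * k.-1 = k * k - k)%N by case: k => //= k; lia.
have bound r k : (r + k = M + M -> r * r.+1 + k * k.-1 <= 2 * (n + M * M.-1) -> M <= n)%N.
  rewrite !pred_sqr; case: (leqP M r) => [le_Mr|lt_rM] defM.
    have [d defr] : exists d, r = (k + d + d)%N by exists (M - k)%N; lia.
    by have -> : M = (k + d)%N by [lia]; subst r; nia.
  have [d defk] : exists d, k = (r + d + d)%N by exists (M - r)%N; lia.
  by have -> : M = (r + d)%N by [lia]; subst k; nia.
case=> [/(bound _ _ defN) | ]; first lia.
by rewrite addnC => /(bound _ _ (etrans (addnC _ _) defN)); lia.
Qed.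

End Rank.

(** * Invariance of delta under the shift of symbols *)

Section SymbolShift.
Local Open Scope fset_scope.
Local Open Scope ring_scope.

Lemma mem_subsets_below_sum L (A : {fset nat}) :
  (\sum_(a <- A) a < L)%N -> A \in subsets_below L.
Proof.
move=> lt_AL; apply/mem_subsets_below => a aA; apply: leq_ltn_trans lt_AL.
by rewrite (big_fsetD1 a) //= leq_addr.
Qed.

Lemma shift0_subsets_below L A : A \in subsets_below L -> shift0 A \in subsets_below L.+1.
Proof.
move/mem_subsets_below => lt_A; apply/mem_subsets_below => -[|a] //.
by rewrite !inE /= mem_shift1 => /lt_A.
Qed.

Definition shift_point (x : bool * nat) : bool * nat := (x.1, x.2.+1).

Lemma points_shift0 L A B : points L.+1 (shift0 A) (shift0 B) =
  [:: (true, 0%N), (false, 0%N) & map shift_point (points L A B)].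
Proof.
elim: L => [|L IH]; first by rewrite /= !inE.
rewrite -[LHS]/(points L.+1 _ _ ++ _ ++ _) IH /= !inE /= !mem_shift1 !map_cat.
by do 2!case: ifP.
Qed.

Variables (R : realType) (q : R).

Lemma dist_prod_shift s :
  dist_prod q (map shift_point s) = q ^+ 'C(size s, 2) * dist_prod q s.
Proof.
elim: s => [|x s IH] /=; first by rewrite mulr1.
rewrite IH big_map binS bin1 exprD.
have -> : \prod_(y <- s) point_dist q (shift_point x) (shift_point y) =
    q ^+ size s * \prod_(y <- s) point_dist q x y.
  rewrite -iter_mulr_1 -(count_predT s) -big_const_seq -big_split.
  by apply: eq_bigr => y _; rewrite /point_dist /point_val /= !exprS; ring.
by ring.
Qed.

(** The new points -1 and 1 are at distance 2; their distances to a shifted point of exponent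
    [a + 1] multiply to [q^(2(a+1)) - 1]; each old distance gains a factor [q]. *)
Lemma symbol_prod_shift A B : symbol_prod q (shift0 A) (shift0 B) =
  2 * q ^+ 'C(#|` A| + #|` B|, 2) * symbol_prod q A B *
  (\prod_(a <- A) (q ^+ (2 * a.+1) - 1) * \prod_(b <- B) (q ^+ (2 * b.+1) - 1)).
Proof.
pose L := (\sum_(a <- A) a + \sum_(b <- B) b).+1.
have inA : A \in subsets_below L by apply: mem_subsets_below_sum; rewrite ltnS leq_addr.
have inB : B \in subsets_below L by apply: mem_subsets_below_sum; rewrite ltnS leq_addl.
rewrite (symbol_prodE _ inA inB).
rewrite (symbol_prodE _ (shift0_subsets_below inA) (shift0_subsets_below inB)).
rewrite points_shift0 /= big_cons dist_prod_shift.
have -> : size (points L A B) = (#|` A| + #|` B|)%N.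
  by rewrite -sum1_size (big_points _ _ inA inB) /= !sum1_size.
rewrite -(big_points _ (fun x => q ^+ (2 * x.2.+1) - 1) inA inB) !big_map.
set P := \prod_(x <- _) (_ ^+ _ - 1).
have -> : P = \prod_(x <- points L A B) point_dist q (true, 0%N) (shift_point x) *
    \prod_(x <- points L A B) point_dist q (false, 0%N) (shift_point x).
  rewrite -big_split; apply: eq_bigr => -[b a] _ /=; rewrite /point_dist /point_val /=.
  rewrite !expr0 expr1 mulnC exprM; case: b => /=; rewrite ?expr0 ?expr1; ring.
rewrite {1}/point_dist /point_val /= !expr0 expr1.
by ring.
Qed.

Definition cM M := (\sum_(i < M) (i * i.-1 + (i * i.-1 + i)))%N.

Lemma bin2_double k : 'C(k + k, 2) = (k * k.-1 + (k * k.-1 + k))%N.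
Proof.
case: k => // k; rewrite bin2 /= -[RHS]doubleK; congr half; rewrite -muln2; lia.
Qed.

Lemma cN_cM M : cN (M + M) = cM M.
Proof.
rewrite /cN /cM; case: M => [|M]; first by rewrite big_ord0 big_geq.
have -> : (((M.+1 + M.+1) - 2)./2.+1 = M.+1)%N by lia.
rewrite big_ord_recl add0n big_add1 big_mkord (reindex_inj rev_ord_inj) /=.
apply: eq_bigr => i _; have lt_iM := ltn_ord i.
have -> : (M.+1 + M.+1 - 2 * (M - i.+1).+1 = i.+1 + i.+1)%N by lia.
by rewrite bin2_double.
Qed.

Lemma qfact_invE a : qfact_inv q a = (\prod_(1 <= j < a.+1) (q ^+ (2 * j) - 1))^-1.
Proof. by rewrite /qfact_inv big_add1 big_mkord prodfV. Qed.

(** The factor 1/2 turns [2^((N-2)/2)] into [2^M], and the convention [delta = 2] at the empty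
    symbol becomes the case [M = 0]. *)
Lemma half_delta (X : symbol) M : symN X = (M + M)%N ->
  2^-1 * delta q X = symbol_prod q X.1 X.2 *
    (\prod_(a <- X.1) qfact_inv q a * \prod_(b <- X.2) qfact_inv q b) / (2 ^+ M * q ^+ cM M).
Proof.
move=> NX; rewrite /delta NX.
have [|nzX] := boolP ((X.1 == fset0) && (X.2 == fset0)).
  case: X NX => A B /= NX /andP[/eqP defA /eqP defB]; move: NX.
  rewrite defA defB /symN !cardfs0 => NX; have -> : M = 0%N by lia.
  by rewrite /symbol_prod !big_nil /cM big_ord0 !mulr1 invr1 mulr1 mulVf // pnatr_eq0.
have M_gt0 : (0 < M)%N.
  move: nzX; rewrite lt0n; apply: contra => /eqP M0; move/eqP: NX.
  by rewrite M0 /symN addn_eq0 !cardfs_eq0.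
rewrite cN_cM /= -/(symbol_prod q X.1 X.2).
under [X in _ = _ * (X * _) * _]eq_bigr do rewrite qfact_invE.
under [X in _ = _ * (_ * X) * _]eq_bigr do rewrite qfact_invE.
rewrite !prodfV !invfM.
have -> : (((M + M) - 2)./2 = M.-1)%N by lia.
have -> : 2 ^- M = 2^-1 * 2 ^- M.-1 :> R by rewrite -invfM -exprS prednK.
by ring.
Qed.

Definition shift_symbol (X : symbol) : symbol := (shift0 X.1, shift0 X.2).

Lemma symN_shift X : symN (shift_symbol X) = (symN X).+2.
Proof. by rewrite /symN !card_shift0 addSn addnS. Qed.

Hypothesis q_gt1 : 1 < q.

Lemma half_delta_shift (X : symbol) M : symN X = (M + M)%N ->
  2^-1 * delta q (shift_symbol X) = 2^-1 * delta q X.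
Proof.
move=> NX; have NX' : symN (shift_symbol X) = (M.+1 + M.+1)%N.
  by rewrite symN_shift NX; lia.
rewrite (half_delta NX) (half_delta NX') /= symbol_prod_shift -/(symN X) NX.
have q0 := q_neq0 q_gt1.
have big0 A : \prod_(a <- shift0 A) qfact_inv q a * \prod_(a <- A) (q ^+ (2 * a.+1) - 1) =
    \prod_(a <- A) qfact_inv q a.
  rewrite big_fsetU1 ?zero_notin_shift1 //= {1}/qfact_inv big_ord0 mul1r big_shift1.
  rewrite -big_split; apply: eq_bigr => a _ /=; rewrite /qfact_inv big_ord_recr /=.
  by rewrite mulfVK // qX_sub1_neq0.
have -> : cM M.+1 = (cM M + 'C(M + M, 2))%N.
  by rewrite /cM big_ord_recr bin2_double.
rewrite -[X in _ = _ * (X * _) / _]big0 -[X in _ = _ * (_ * X) / _]big0.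
set S := symbol_prod q _ _; set C := 'C(_, _).
set a1 := \prod_(a <- _) _; set a2 := \prod_(a <- _) _; set a3 := \prod_(a <- _) _.
set a4 := \prod_(a <- _) _; rewrite exprS exprD.
have nz2 : (2 : R) != 0 by rewrite pnatr_eq0.
have z1 : 2 ^+ M != 0 :> R by rewrite expf_neq0.
have z2 : q ^+ cM M != 0 by rewrite expf_neq0.
have z3 : q ^+ C != 0 by rewrite expf_neq0.
by field; rewrite z1 z2 z3.
Qed.

End SymbolShift.

(** * The coefficients of T as Toeplitz determinants *)

Section CoefficientOfT.
Variables (R : realType) (q : R).
Hypothesis q_gt1 : 1 < q.

Definition symbols_below L : seq symbol :=
  [seq (A, B) | A <- subsets_below L, B <- subsets_below L].

Lemma mem_symbols_below L (X : symbol) : (sym_sum X < L)%N -> X \in symbols_below L.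
Proof.
case: X => A B; rewrite /sym_sum /= => ltL; apply: allpairs_f;
by apply: mem_subsets_below_sum; apply: leq_ltn_trans ltL; rewrite ?leq_addr ?leq_addl.
Qed.

Lemma uniq_symbols_below L : uniq (symbols_below L).
Proof.
apply: allpairs_uniq; [exact: uniq_subsets_below | exact: uniq_subsets_below |].
by move=> [A B] [A' B'] _ _ /= [-> ->].
Qed.

Lemma finite_sym_sum b (S : set symbol) :
  (forall X, S X -> (sym_sum X <= b)%N) -> finite_set S.
Proof.
move=> leS; apply: (@sub_finite_set _ _ [set` symbols_below b.+1]); last exact: finite_seq.
by move=> X /leS leX; apply: mem_symbols_below.
Qed.

Definition all_symbols (n M : nat) : set symbol :=
  [set X | symN X = (M + M)%N /\ sym_sum X = (n + M * M.-1)%N].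

Definition new_symbols (n M : nat) : set symbol :=
  [set X | is_ortho_symbol X /\ symN X = (M + M)%N /\ sym_sum X = (n + M * M.-1)%N].

Definition ortho_symbols (n M : nat) : set symbol :=
  [set X | is_ortho_symbol X /\ even_defect X /\ sym_rank X = n%:Z /\ (symN X <= M + M)%N].

Lemma finite_all_symbols n M : finite_set (all_symbols n M).
Proof. by apply: (@finite_sym_sum (n + M * M.-1)) => X [_ ->]. Qed.

Lemma finite_new_symbols n M : finite_set (new_symbols n M).
Proof. by apply: (@finite_sym_sum (n + M * M.-1)) => X [_ [_ ->]]. Qed.

Lemma even_symN (X : symbol) : even_defect X -> symN X = ((symN X)./2 + (symN X)./2)%N.
Proof. by move=> eX; rewrite addnn even_halfK. Qed.

Lemma finite_ortho_symbols n M : finite_set (ortho_symbols n M).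
Proof.
apply: (@finite_sym_sum (n + M * M)) => X [_ [/even_symN eX [/(sym_rankE _ eX) -> leN]]].
by rewrite leq_add2l leq_mul //; lia.
Qed.

Lemma ortho_symbolsS n M :
  ortho_symbols n M.+1 = ortho_symbols n M `|` new_symbols n M.+1.
Proof.
apply/seteqP; split=> X.
  move=> [oX [eX [rX leN]]]; have defN := even_symN eX.
  have [leN'|ltN] := leqP (symN X) (M + M); first by left.
  have NX : symN X = (M.+1 + M.+1)%N by lia.
  by right; split=> //; split=> //; apply/(sym_rankE _ NX).
move=> [[oX [eX [rX leN]]]|[oX [NX sX]]].
  by do 3!split=> //; lia.
split=> //; split; first by rewrite /even_defect NX oddD addbb.
by split; [apply/(sym_rankE _ NX) | rewrite NX].
Qed.

Definition both_zero : set symbol := [set X : symbol | (0%N \in X.1) && (0%N \in X.2)].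

Lemma sum_shift_symbol X : sym_sum (shift_symbol X) = (sym_sum X + symN X)%N.
Proof. by rewrite /sym_sum /symN /= !sum_shift0 addnACA. Qed.

Lemma shift_symbol_bij n M :
  set_bij (all_symbols n M) (all_symbols n M.+1 `&` both_zero) shift_symbol.
Proof.
have sumE M' : (n + M'.+1 * M' = n + M' * M'.-1 + (M' + M'))%N.
  by case: M' => [|k] /=; lia.
split.
- move=> X [NX sX]; split; last by rewrite /both_zero /= !inE.
  split; first by rewrite symN_shift NX addSn addnS.
  by rewrite sum_shift_symbol sX NX sumE.
- move=> [A B] [A' B'] _ _ [eqA eqB].
  by rewrite -(unshift_shift0 A) -(unshift_shift0 B) eqA eqB !unshift_shift0.
- move=> [A B] [[NX sX] /andP[/= zA zB]].
  have defX : shift_symbol (unshift A, unshift B) = (A, B).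
    by rewrite /shift_symbol /= !shift0_unshift.
  exists (unshift A, unshift B) => //; move: NX sX; rewrite -defX symN_shift sum_shift_symbol.
  rewrite addSn addnS => -[NX] sX; split=> //; move: sX.
  by rewrite NX /= sumE => /addIn.
Qed.

(** Induction on [M]: a symbol with [2(M+1)] entries either has 0 on both sides, and is the shift of
    a unique one with [2M] entries and equal [delta], or is orthogonal and new. *)
Lemma sum_all_symbols n M :
  \sum_(X \in ortho_symbols n M) (2^-1 * delta q X) =
  \sum_(X \in all_symbols n M) (2^-1 * delta q X).
Proof.
elim: M => [|M IH].
  apply: eq_fsbigl; apply/seteqP; split=> X.
    move=> [_ [_ [rX leN]]]; have NX : symN X = (0 + 0)%N by lia.
    by split=> //; apply/(sym_rankE _ NX).
  move=> [NX sX]; split.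
    move=> /andP[z1 _]; move/eqP: NX; rewrite /symN addn_eq0 !cardfs_eq0 => /andP[/eqP A0 _].
    by rewrite A0 inE in z1.
  by split; [rewrite /even_defect NX | split; [apply/(sym_rankE _ NX) | rewrite NX]].
rewrite ortho_symbolsS fsbigU0; last first.
- move=> X [[_ [_ [_ leN]]] [_ [NX _]]] /=; lia.
- exact: finite_new_symbols.
- exact: finite_ortho_symbols.
rewrite IH [RHS](fsbigID both_zero) /=; last exact: finite_all_symbols.
congr (_ + _).
  rewrite (reindex_fsbig _ _ _ _ (shift_symbol_bij n M)).
  by apply: eq_fsbigr => X; rewrite in_setE => -[NX _]; rewrite (half_delta_shift q_gt1 NX).
by apply: eq_fsbigl; apply/seteqP; split=> X; [move=> [oX [NX sX]] | move=> [[NX sX] oX]].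
Qed.

Lemma T_coef_all_symbols n M : (n <= M)%N ->
  T_coef q n = \sum_(X \in all_symbols n M) (2^-1 * delta q X).
Proof.
move=> le_nM; rewrite -sum_all_symbols; apply: eq_fsbigl; apply/seteqP; split=> X.
  move=> [oX [eX rX]]; do 3!split=> //.
  by apply: leq_trans (ortho_symN_le oX eX rX) _; rewrite leq_add.
by move=> [oX [eX [rX _]]].
Qed.

Lemma qfact_inv_rec a : qfact_inv q a.+1 * (q ^+ (2 * a.+1) - 1) = qfact_inv q a.
Proof. by rewrite /qfact_inv big_ord_recr /= mulfVK // qX_sub1_neq0. Qed.

Lemma T_coef_det n M : (n <= M)%N ->
  T_coef q n = (\det (toep_mx q (qfact_inv q) M (M + n)))`_n.
Proof.
move=> le_nM; rewrite (T_coef_all_symbols le_nM).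
(* Exceeds every entry of a symbol in [all_symbols n M], and is at least [M + n] as stability
   requires. *)
pose L := (M + n + M * M.-1).+1; pose u := qfact_inv q.
rewrite -(@det_toep_mx_stable _ q u M n L _ n) //; last by rewrite /L; lia.
pose P (X : symbol) := (symN X == (M + M)%N) && (sym_sum X == n + M * M.-1)%N.
have -> : all_symbols n M = [set` [seq X <- symbols_below L | P X]].
  apply/seteqP; split=> X /=; rewrite mem_filter.
    move=> [NX sX]; rewrite /P NX sX !eqxx /=; apply: mem_symbols_below.
    by rewrite sX /L; lia.
  by move=> /andP[/andP[/eqP NX /eqP sX] _].
rewrite -fsbig_seq ?filter_uniq ?uniq_symbols_below // big_filter big_mkcond big_allpairs /=.
have nzd : 2 ^+ M * q ^+ cM M != 0.
  by rewrite mulf_neq0 // expf_neq0 ?pnatr_eq0 // q_neq0.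
have := symbol_sum_pair_mx q u M L.
rewrite (@det_pair_mx _ q u M qfact_inv_rec) -/(cM M).
(* The entries of a symbol of rank [n] with [2M] entries sum to [n + M * M.-1]. *)
move=> /(congr1 (fun p : {poly R} => p`_(n + M * M.-1))).
have -> : (2 ^+ M * ((q ^+ cM M)%:P * 'X^(M * M.-1) * \det (toep_mx q u M L)))`_(n + M * M.-1)
    = 2 ^+ M * q ^+ cM M * (\det (toep_mx q u M L))`_n.
  set D := \det _; set c := q ^+ _.
  have -> : 2 ^+ M * (c%:P * 'X^(M * M.-1) * D) = (2 ^+ M * c)%:P * (D * 'X^(M * M.-1)).
    by rewrite polyCM [(2 ^+ M)%:P]polyC_exp polyC_natr; ring.
  by rewrite coefCM coefMXn ltnNge leq_addl addnK.
move=> eqT; apply: (mulfI nzd); rewrite -eqT coef_sum mulr_sumr.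
apply: eq_bigr => A _; rewrite coef_sum mulr_sumr [RHS]big_mkcond /=; apply: eq_bigr => B _.
rewrite /P /symN /sym_sum /=; case: eqP => [NX|_] /=; last by rewrite mulr0.
have wE C : \prod_(a <- C) weight u a = (\prod_(a <- C) u a)%:P * 'X^(\sum_(a <- C) a).
  by rewrite big_split /= rmorph_prod expr_sum.
have -> : symbol_prod q%:P A B = (symbol_prod q A B)%:P.
  by rewrite /symbol_prod !rmorphM !rmorph_prod /=; congr (_ * _ * _);
     apply: eq_bigr => a _; rewrite rmorph_prod; apply: eq_bigr => b _;
     rewrite ?rmorphB ?rmorphD !rmorphXn.
rewrite !wE mulrACA -exprD -polyCM mulrA -polyCM coefCM coefXn eq_sym.
case: eqP => [_|_]; last by rewrite !mulr0.
by rewrite mulr1 (@half_delta _ q (A, B) M) // mulrC mulfVK.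
Qed.

End CoefficientOfT.

(* The infinite product is understood coefficientwise as the limit of the
   partial products over indices <= M. *)
Theorem theorem8p1 (R : realType) (q : nat)
  (hq : exists p k : nat, [/\ prime p, (0 < k)%N & q = (p ^ k)%N]) (n : nat) :
  partial_prod (q%:R : R) M n @[M --> \oo] --> T_coef (q%:R : R) n.
Proof.
have q_gt1 : 1 < q%:R :> R.
  have [p [k [p_pr k_gt0 ->]]] := hq.
  by rewrite ltr1n -(exp1n k) ltn_exp2r // prime_gt1.
(* The choice [M = n + 1] is positive also for [n = 0], as [cvg_partial_prod] demands. *)
rewrite (T_coef_det q_gt1 (leqnSn n)).
exact: cvg_partial_prod.
Qed.
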